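(* Let a DAE system with regular pencil $\lambda E-A$ be given that is asymptotically stable and whose transfer function $G\in\mathcal{H}_2$ is strictly proper ($p$ outputs, $m$ inputs). Let $A_M\in\mathbb{C}^{q\times q}$ be diagonalizable with all eigenvalues in the open left half-plane and let $B_M\in\mathbb{C}^{q\times m}$. Let $G_r\in\mathcal{G}(A_M,B_M)$. Then the following are equivalent: (i) $G_r$ is the unique $\mathcal{H}_2$ pseudo-optimal reduced transfer function for $G$ with respect to $\mathcal{G}(A_M,B_M)$; (ii) $\langle G-G_r,\,G_M\rangle_{\mathcal{H}_2}=0$ for all $G_M\in\mathcal{G}(A_M,B_M)$; (iii) $\left(G(-\overline{\lambda}_{M i})-G_r(-\overline{\lambda}_{M i})\right)b_{M i}^{*}=0$ for $i=1,\dots,q$, where $\lambda_{M1},\dots,\lambda_{Mq}$ and $b_{M1}^{*},\dots,b_{Mq}^{*}$ are the poles and input residual directions shared by the elements of $\mathcal{G}(A_M,B_M)$.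
   Context: A DAE system is $E\dot x(t)=Ax(t)+Bu(t)$, $y(t)=Cx(t)+Du(t)$ with real matrices $E,A\in\mathbb{R}^{n\times n}$, $B\in\mathbb{R}^{n\times m}$, $C\in\mathbb{R}^{p\times n}$, $D\in\mathbb{R}^{p\times m}$, $E$ possibly singular; its transfer function is $G(s)=C(sE-A)^{-1}B+D$. The pencil $\lambda E-A$ is regular if $\det(\lambda E-A)\not\equiv0$. The system is asymptotically stable if all finite generalized eigenvalues of $\lambda E-A$ have negative real part. A rational matrix function is strictly proper if it tends to $0$ as $s\to\infty$. $\mathcal{H}_2$ is the space of $p\times m$ rational matrix functions (complex coefficients allowed) that are analytic in the closed right half-plane and square integrable on the imaginary axis, with inner product $\langle F,H\rangle_{\mathcal{H}_2}=\frac{1}{2\pi}\int_{-\infty}^{\infty}\operatorname{tr}(F(\imath\omega)H(\imath\omega)^{*})\,d\omega$ and induced norm $\|\cdot\|_{\mathcal{H}_2}$; $^{*}$ is the conjugate transpose. For diagonalizable $A_M$ with all eigenvalues in the open left half-plane, $$\mathcal{G}(A_M,B_M)=\left\{G_M \;:\; \exists\, C_M\in\mathbb{C}^{p\times q},\ G_M(s)=C_M(sI_q-A_M)^{-1}B_M\right\}\subset\mathcal{H}_2 .$$ Poles and input residual directions: take a nonsingular $T$ with $T^{-1}A_MT=\operatorname{diag}(\lambda_{M1},\dots,\lambda_{Mq})$; then $b_{Mi}\in\mathbb{C}^{1\times m}$ is the $i$-th row of $T^{-1}B_M$ and $b_{Mi}^{*}\in\mathbb{C}^{m}$ is the $i$-th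 input residual direction. $G_r$ is called $\mathcal{H}_2$ pseudo-optimal with respect to $\mathcal{G}(A_M,B_M)$ if $G_r\in\mathcal{G}(A_M,B_M)$ and $\|G-G_r\|_{\mathcal{H}_2}=\min_{G_M\in\mathcal{G}(A_M,B_M)}\|G-G_M\|_{\mathcal{H}_2}$. *)

(* Defs.v *)
From HB Require Import structures.
From mathcomp Require Import all_boot all_order all_algebra.
From mathcomp Require Import fraction spectral sesquilinear complex.
From mathcomp Require Import all_classical all_reals all_analysis.

Set Implicit Arguments.
Unset Strict Implicit.
Unset Printing Implicit Defensive.

Import Order.TTheory GRing.Theory Num.Theory.
Import numFieldNormedType.Exports.

Local Open Scope ring_scope.
Local Open Scope complex_scope.
Local Open Scope sesquilinear_scope.
Local Open Scope classical_set_scope.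

(* Rational functions are elements of the fraction field of C[s], so that equality
   is equality of rational functions; C is R[i] for an arbitrary realType R. *)
Notation ratfun R := {fraction {poly R[i]}}.

Local Notation "x %:F" := (tofrac x).

Section RationalFunctions.
Variable R : realType.
Local Notation C := R[i].

Definition ratX : ratfun R := ('X : {poly C})%:F.

Definition rat_cst (z : C) : ratfun R := (z%:P)%:F.

(* Value at s of the reduced fraction; by the convention x / 0 = 0 it is 0 at a
   pole.  See [rat_evalE]. *)
Definition rat_eval (f : ratfun R) (s : C) : C :=
  let: (n, d) := frac (repr f) in
  (n %/ gcdp n d).[s] / (d %/ gcdp n d).[s].

(* Complex differentiable in a neighbourhood of s; this fails at a pole, where the
   conventional value 0 makes rat_eval f discontinuous. *)
Definition rat_analytic_at (f : ratfun R) (s : C) : Prop :=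
  \forall z \near (s : C^o), derivable (rat_eval f : C^o -> C^o) z 1.

Definition ratmx_eval p m (F : 'M[ratfun R]_(p, m)) (s : C) : 'M[C]_(p, m) :=
  map_mx (rat_eval ^~ s) F.

Definition strictly_proper p m (F : 'M[ratfun R]_(p, m)) : Prop :=
  forall i j (eps : R), 0 < eps ->
    exists M : R, forall s : C, M%:C < `|s| -> `|ratmx_eval F s i j| < eps%:C.

End RationalFunctions.

Section DAE.
Variable R : realType.
Local Notation C := R[i].

Definition toCmx p m (A : 'M[R]_(p, m)) : 'M[C]_(p, m) := map_mx (real_complex R) A.

Definition regular_pencil n (E A : 'M[R]_n) : Prop :=
  \det ('X *: map_mx polyC E - map_mx polyC A) != 0 :> {poly R}.

Definition gen_eigenvalue n (E A : 'M[R]_n) (lam : C) : Prop :=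
  \det (lam *: toCmx E - toCmx A) = 0.

Definition asymptotically_stable n (E A : 'M[R]_n) : Prop :=
  forall lam : C, gen_eigenvalue E A lam -> complex.Re lam < 0.

(* C (sE - A)^{-1} B + D computed over the field C(s); see [ratmx_eval_transfer]
   for its values. *)
Definition transfer n m p (E A : 'M[C]_n) (B : 'M[C]_(n, m)) (Cm : 'M[C]_(p, n))
    (D : 'M[C]_(p, m)) : 'M[ratfun R]_(p, m) :=
  let k := @rat_cst R in
  map_mx k Cm *m invmx (ratX R *: map_mx k E - map_mx k A) *m map_mx k B
    + map_mx k D.

Definition dae_transfer n m p (E A : 'M[R]_n) (B : 'M[R]_(n, m))
    (Cm : 'M[R]_(p, n)) (D : 'M[R]_(p, m)) : 'M[ratfun R]_(p, m) :=
  transfer (toCmx E) (toCmx A) (toCmx B) (toCmx Cm) (toCmx D).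

End DAE.

Section HardySpace.
Variable R : realType.
Local Notation C := R[i].

Definition integralC (f : R -> C) : C :=
  (\int[@lebesgue_measure R]_w (complex.Re (f w)))
    +i* (\int[@lebesgue_measure R]_w (complex.Im (f w))).

Definition H2_integrand p m (F H : 'M[ratfun R]_(p, m)) (w : R) : C :=
  \tr (ratmx_eval F (0 +i* w) *m (ratmx_eval H (0 +i* w)) ^t*).

(* The trace below is real: it is the squared Frobenius norm of F(i w). *)
Definition H2 p m : set 'M[ratfun R]_(p, m) :=
  [set F : 'M[ratfun R]_(p, m) | (forall i j (s : C), 0 <= complex.Re s -> rat_analytic_at (F i j) s) /\
    (@lebesgue_measure R).-integrable setT
      (fun w : R => (complex.Re (H2_integrand F F w))%:E)].

Definition H2_inner p m (F H : 'M[ratfun R]_(p, m)) : C :=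
  ((2 * pi)^-1)%:C * integralC (H2_integrand F H).

Definition H2_norm p m (F : 'M[ratfun R]_(p, m)) : R :=
  Num.sqrt (complex.Re (H2_inner F F)).

Definition reduced_models p m q (AM : 'M[C]_q) (BM : 'M[C]_(q, m)) :
    set 'M[ratfun R]_(p, m) :=
  [set GM | exists CM : 'M[C]_(p, q), GM = transfer 1%:M AM BM CM 0].

Definition pseudo_optimal p m (G : 'M[ratfun R]_(p, m)) q (AM : 'M[C]_q)
    (BM : 'M[C]_(q, m)) (Gr : 'M[ratfun R]_(p, m)) : Prop :=
  @reduced_models p m q AM BM Gr /\
  forall GM, @reduced_models p m q AM BM GM -> H2_norm (G - Gr) <= H2_norm (G - GM).

Definition unique_pseudo_optimal p m (G : 'M[ratfun R]_(p, m)) q (AM : 'M[C]_q)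
    (BM : 'M[C]_(q, m)) (Gr : 'M[ratfun R]_(p, m)) : Prop :=
  pseudo_optimal G AM BM Gr /\
  forall Gr', pseudo_optimal G AM BM Gr' -> Gr' = Gr.

(* The i-th input residual direction: the conjugate transpose of row i of
   T^{-1} B_M. *)
Definition input_direction m q (T : 'M[C]_q) (BM : 'M[C]_(q, m)) (i : 'I_q) :
    'cV[C]_m :=
  (row i (invmx T *m BM)) ^t*.

End HardySpace.

Section Evaluation.
Variable R : realType.
Local Notation C := R[i].

Lemma rat_evalE (n d : {poly C}) (s : C) :
  d.[s] != 0 -> rat_eval (n%:F / d%:F) s = n.[s] / d.[s].
Proof.
move=> ds0; rewrite /rat_eval.
set f := (n%:F / d%:F : ratfun R).
case fr: (frac (repr f)) => [n' d']; set g := gcdp n' d'.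
have d0 : d != 0 by apply: contraNneq ds0 => ->; rewrite horner0.
have d'0 : d' != 0 by have := denom_ratioP (repr f); rewrite fr.
have fE : f * d'%:F = n'%:F.
  rewrite -[f]reprK; move: fr; case: (repr f) => -[a b] /= b0 [ab bd]; subst a b.
  unlock tofrac; rewrite -[LHS]pi_mul; apply/eqmodP => /=.
  rewrite /= equivfE /FracField.mulf /=.
  by rewrite !numden_Ratio ?oner_neq0 ?mulr1 //= mulrC.
have eqnd : n * d' = n' * d.
  apply/eqP; rewrite -tofrac_eq !tofracM -fE /f.
  by rewrite mulrAC divfK ?tofrac_eq0.
have g0 : g != 0 by rewrite gcdp_eq0 negb_and d'0 orbT.
have nE : n' = n' %/ g * g by rewrite divpK // dvdp_gcdl.
have dE : d' = d' %/ g * g by rewrite divpK // dvdp_gcdr.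
have cop : coprimep (n' %/ g) (d' %/ g) by rewrite coprimep_div_gcd // d'0 orbT.
set a := n' %/ g in nE cop *; set b := d' %/ g in dE cop *.
have eqab : n * b = a * d.
  by apply: (mulIf g0); rewrite -mulrA -dE eqnd {1}nE mulrAC.
have bd : b %| d.
  by rewrite -(@Gauss_dvdpr _ d a b) 1?coprimep_sym // -eqab dvdp_mull.
have bs0 : b.[s] != 0.
  by apply: contraNneq ds0 => bs; rewrite -(divpK bd) hornerM bs mulr0.
by apply/eqP; rewrite eqr_div // -!hornerM -eqab.
Qed.

Lemma ratmx_eval_transfer n m p (E A : 'M[C]_n) (B : 'M[C]_(n, m))
    (Cm : 'M[C]_(p, n)) (D : 'M[C]_(p, m)) (s : C) :
  s *: E - A \in unitmx ->
  ratmx_eval (transfer E A B Cm D) s = Cm *m invmx (s *: E - A) *m B + D.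
Proof.
move=> Muni.
pose k := map_mx (polyC : C -> {poly C}).
pose P := 'X *: k _ _ E - k _ _ A.
pose N := k _ _ Cm *m \adj P *m k _ _ B + \det P *: k _ _ D.
have hP : map_mx (horner_eval s) P = s *: E - A.
  by apply/matrixP => i j; rewrite !mxE /horner_eval !hornerE.
have hk a b (Q : 'M[C]_(a, b)) : map_mx (horner_eval s) (k _ _ Q) = Q.
  by apply/matrixP => i j; rewrite !mxE /horner_eval hornerC.
have dPs : (\det P).[s] = \det (s *: E - A).
  by rewrite -hP det_map_mx.
have d0 : \det (s *: E - A) != 0 by rewrite -unitfE -unitmxE.
have dP0 : \det P != 0.
  by apply: contraNneq d0 => P0; rewrite -dPs P0 horner0.
have PF : ratX R *: map_mx (@rat_cst R) E - map_mx (@rat_cst R) A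
    = map_mx (@tofrac _) P.
  by apply/matrixP => i j; rewrite !mxE tofracB tofracM.
have cF a b (Q : 'M[C]_(a, b)) :
    map_mx (@rat_cst R) Q = map_mx (@tofrac _) (k _ _ Q).
  by apply/matrixP => i j; rewrite !mxE.
have -> : transfer E A B Cm D = map_mx (fun r => r%:F / (\det P)%:F) N.
  rewrite /transfer PF !cF.
  have Pu : map_mx (@tofrac _) P \in unitmx.
    by rewrite unitmxE det_map_mx unitfE tofrac_eq0.
  rewrite /invmx Pu -map_mx_adj det_map_mx -scalemxAr -scalemxAl -!map_mxM.
  apply/matrixP => i j; rewrite !mxE tofracD tofracM mulrDl.
  by congr (_ + _); [exact: mulrC | rewrite mulrAC divff ?tofrac_eq0 ?mul1r].
have NE : map_mx (horner_eval s) N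
    = Cm *m \adj (s *: E - A) *m B + \det (s *: E - A) *: D.
  by rewrite map_mxD map_mxZ !map_mxM map_mx_adj !hk hP -dPs.
have -> : ratmx_eval (map_mx (fun r => r%:F / (\det P)%:F) N) s
    = (\det (s *: E - A))^-1 *: map_mx (horner_eval s) N.
  by apply/matrixP => i j; rewrite !mxE rat_evalE dPs // mulrC.
rewrite NE scalerDr scalerA mulVf // scale1r /invmx Muni.
by rewrite -scalemxAr -scalemxAl.
Qed.

End Evaluation.

(* Main.v *)
Require Import Defs.
From HB Require Import structures.
From mathcomp Require Import all_boot all_order all_algebra.
From mathcomp Require Import all_classical all_reals all_analysis.
From mathcomp Require Import fraction spectral sesquilinear complex.
From mathcomp Require Import measurable_realfun ring lra.

(** The best approximation of G from a finite-dimensional subspace of H2 is the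
    point whose error is orthogonal to the subspace; that orthogonality
    characterizes it, and that it is unique, follow from Pythagoras and from the
    definiteness of the norm ([minimizer_orthogonal],
    [orthogonal_unique_minimizer]).  This is the equivalence of the first two
    conditions.

    For the other equivalence, the reduced models are exactly the combinations
    of the functions 1 / (s - lam_k) with coefficients c_k b_k, where b_k is the
    k-th row of T^-1 B_M and c_k is an arbitrary column ([transfer_diag]).
    In H2, taking the inner product with 1 / (s - lam_k) evaluates a function at
    the mirror image - conj(lam_k) of the pole ([rat_inner_pole]), so
      <F, G_M> = sum_k c_k^* F(- conj(lam_k)) b_k^* .
    Since the c_k are arbitrary, orthogonality to all reduced models says
    precisely that F(- conj(lam_k)) b_k^* = 0 for every k
    ([orthogonal_interpolation]).

    The analytic content is thus the Cauchy formula
      integral of f(i w) / (mu - i w) dw = 2 pi f(mu),   Re mu > 0,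
    for f rational, strictly proper and with all its poles in the left
    half-plane.  No contour is deformed.  Newton's form of the numerator
    ([stable_sp_ind]) reduces it to products of functions 1 / (s - a), and
    partial fractions reduce those to single fractions and their powers, whose
    primitives on the axis are explicit: an arctangent and a logarithm, or
    another power.  Single fractions are not integrable, so the computation is
    carried out with symmetric limits of primitives ([pv_integral]), and
    converted to a Lebesgue integral at the end ([FTC_line], [integralC_pv]).

    The transfer function of the DAE belongs to this class of functions: by
    Cramer's rule its poles are eigenvalues of the pencil, and strict properness
    removes its polynomial part ([dae_transfer_stable_sp]). *)

Set Implicit Arguments.
Unset Strict Implicit.
Unset Printing Implicit Defensive.

Import Order.TTheory GRing.Theory Num.Theory.
Import numFieldNormedType.Exports.

Local Open Scope ring_scope.
Local Open Scope complex_scope.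

(** * Calculus of complex-valued functions of a real variable *)

Section ComplexValuedCalculus.
Local Notation Re := complex.Re.
Local Notation Im := complex.Im.
Local Notation "z ^*" := (conjc z) : ring_scope.
Local Open Scope classical_set_scope.
Variable R : realType.
Local Notation C := R[i].
Implicit Types (f g F : R -> C) (z l a mu : C).

Lemma cReD z a : Re (z + a) = Re z + Re a. Proof. by case: z a => [? ?] []. Qed.
Lemma cImD z a : Im (z + a) = Im z + Im a. Proof. by case: z a => [? ?] []. Qed.
Lemma cReN z : Re (- z) = - Re z. Proof. by case: z. Qed.
Lemma cImN z : Im (- z) = - Im z. Proof. by case: z. Qed.
Lemma cReM z a : Re (z * a) = Re z * Re a - Im z * Im a.
Proof. by case: z a => [? ?] []. Qed.
Lemma cImM z a : Im (z * a) = Re z * Im a + Im z * Re a.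
Proof. by case: z a => [? ?] []. Qed.
Lemma cReJ z : Re z^* = Re z. Proof. by case: z. Qed.
Lemma cImJ z : Im z^* = - Im z. Proof. by case: z. Qed.
Lemma complex_eq z a : Re z = Re a -> Im z = Im a -> z = a.
Proof. by case: z a => [? ?] [] /= ? ? -> ->. Qed.

Definition ccontinuous f :=
  continuous (fun x => Re (f x)) /\ continuous (fun x => Im (f x)).

Definition cderivative F f := forall x : R,
  is_derive x 1 (fun t => Re (F t)) (Re (f x)) /\
  is_derive x 1 (fun t => Im (F t)) (Im (f x)).

Definition ccvgy f l :=
  (Re (f x) @[x --> +oo] --> Re l) /\ (Im (f x) @[x --> +oo] --> Im l).

Lemma ccontinuousD f g : ccontinuous f -> ccontinuous g ->
  ccontinuous (fun x => f x + g x).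
Proof.
move=> [f1 f2] [g1 g2]; split => x; rewrite /continuous_at.
  under eq_fun do rewrite cReD; rewrite cReD; exact: cvgD (f1 x) (g1 x).
under eq_fun do rewrite cImD; rewrite cImD; exact: cvgD (f2 x) (g2 x).
Qed.

Lemma ccontinuousM f g : ccontinuous f -> ccontinuous g ->
  ccontinuous (fun x => f x * g x).
Proof.
move=> [f1 f2] [g1 g2]; split => x; rewrite /continuous_at.
  under eq_fun do rewrite cReM; rewrite cReM.
  exact: cvgB (cvgM (f1 x) (g1 x)) (cvgM (f2 x) (g2 x)).
under eq_fun do rewrite cImM; rewrite cImM.
exact: cvgD (cvgM (f1 x) (g2 x)) (cvgM (f2 x) (g1 x)).
Qed.

Lemma ccontinuous_cst z : ccontinuous (fun=> z).
Proof. by split => x; exact: cvg_cst. Qed.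

Lemma ccontinuousJ f : ccontinuous f -> ccontinuous (fun x => (f x)^*).
Proof.
move=> [f1 f2]; split => x; rewrite /continuous_at.
  under eq_fun do rewrite cReJ; rewrite cReJ; exact: f1.
under eq_fun do rewrite cImJ; rewrite cImJ; exact: cvgN (f2 x).
Qed.

Lemma cderivativeD F f G g : cderivative F f -> cderivative G g ->
  cderivative (fun x => F x + G x) (fun x => f x + g x).
Proof.
move=> dF dG x; have [F1 F2] := dF x; have [G1 G2] := dG x.
split; rewrite ?cReD ?cImD.
  by under eq_fun do rewrite cReD; exact: is_deriveD F1 G1.
by under eq_fun do rewrite cImD; exact: is_deriveD F2 G2.
Qed.

Lemma cderivativeM F f G g : cderivative F f -> cderivative G g ->
  cderivative (fun x => F x * G x) (fun x => F x * g x + f x * G x).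
Proof.
move=> dF dG x; have [F1 F2] := dF x; have [G1 G2] := dG x.
split.
  under eq_fun do rewrite cReM.
  apply: is_derive_eq (is_deriveB (is_deriveM F1 G1) (is_deriveM F2 G2)) _.
  by rewrite cReD !cReM /GRing.scale /=; ring.
under eq_fun do rewrite cImM.
apply: is_derive_eq (is_deriveD (is_deriveM F1 G2) (is_deriveM F2 G1)) _.
by rewrite cImD !cImM /GRing.scale /=; ring.
Qed.

Lemma cderivative_cst z : cderivative (fun=> z) (fun=> 0).
Proof. by move=> x; split; exact: is_derive_cst. Qed.

Lemma cderivativeJ F f : cderivative F f ->
  cderivative (fun x => (F x)^*) (fun x => (f x)^*).
Proof.
move=> dF x; have [F1 F2] := dF x; split.
  by under eq_fun do rewrite cReJ; rewrite cReJ.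
by under eq_fun do rewrite cImJ; rewrite cImJ; exact: is_deriveN F2.
Qed.

Lemma ccvgyD f g l m : ccvgy f l -> ccvgy g m -> ccvgy (fun x => f x + g x) (l + m).
Proof.
move=> [f1 f2] [g1 g2]; split.
  under eq_fun do rewrite cReD; rewrite cReD; exact: cvgD f1 g1.
under eq_fun do rewrite cImD; rewrite cImD; exact: cvgD f2 g2.
Qed.

Lemma ccvgyM f g l m : ccvgy f l -> ccvgy g m -> ccvgy (fun x => f x * g x) (l * m).
Proof.
move=> [f1 f2] [g1 g2]; split.
  under eq_fun do rewrite cReM; rewrite cReM.
  exact: cvgB (cvgM f1 g1) (cvgM f2 g2).
under eq_fun do rewrite cImM; rewrite cImM.
exact: cvgD (cvgM f1 g2) (cvgM f2 g1).
Qed.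

Lemma ccvgy_cst z : ccvgy (fun=> z) z.
Proof. by split; exact: cvg_cst. Qed.

Lemma ccvgyJ f l : ccvgy f l -> ccvgy (fun x => (f x)^*) l^*.
Proof.
move=> [f1 f2]; split.
  by under eq_fun do rewrite cReJ; rewrite cReJ.
by under eq_fun do rewrite cImJ; rewrite cImJ; exact: cvgN f2.
Qed.

(** Principal value: [l] is the limit of the integrals of [f] from -x to x, in
    terms of a primitive.  Stated this way it is closed under linear combinations at no
    cost, and it applies to 1 / (s - a), which is not integrable on the line
    and only enters the argument inside integrable combinations. *)
Definition pv_integral f l :=
  exists2 F, cderivative F f & ccvgy (fun x => F x - F (- x)) l.

Lemma eq_pv_integral f g l : f =1 g -> pv_integral f l -> pv_integral g l.
Proof. by move=> /funext ->. Qed.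

Lemma pv_integralD f g l m : pv_integral f l -> pv_integral g m ->
  pv_integral (fun x => f x + g x) (l + m).
Proof.
move=> [F dF Fl] [G dG Gm]; exists (fun x => F x + G x); first exact: cderivativeD.
have := ccvgyD Fl Gm; congr ccvgy; apply/funext => x; ring.
Qed.

Lemma pv_integralZ c f l : pv_integral f l ->
  pv_integral (fun x => c * f x) (c * l).
Proof.
move=> [F dF Fl]; exists (fun x => c * F x).
  move=> x; have := cderivativeM (cderivative_cst c) dF x.
  by rewrite mul0r addr0.
have := ccvgyM (ccvgy_cst c) Fl; congr ccvgy; apply/funext => x; ring.
Qed.

Lemma pv_integralJ f l : pv_integral f l -> pv_integral (fun x => (f x)^*) l^*.
Proof.
move=> [F dF Fl]; exists (fun x => (F x)^*); first exact: cderivativeJ.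
have := ccvgyJ Fl; congr ccvgy; apply/funext => x.
by rewrite [in LHS]rmorphB.
Qed.

(** For an integrable function, dominated convergence identifies the integral
    over the line with the limit of the integrals from -n to n, and these are
    given by the primitive. *)
Lemma FTC_line (f F : R -> R) (l : R) : continuous f ->
  (forall x : R, is_derive x 1 F (f x)) ->
  (@lebesgue_measure R).-integrable setT (EFin \o f) ->
  F x - F (- x) @[x --> +oo] --> l ->
  \int[@lebesgue_measure R]_x f x = l.
Proof.
move=> cf dF intf Fl.
pose mu := @lebesgue_measure R.
(* The index n.+1 keeps the intervals nondegenerate. *)
pose D n := `[(- (n.+1%:R : R)), n.+1%:R]%classic.
have mD n : measurable (D n) by exact: measurable_itv.
have mf : measurable_fun setT f by exact: continuous_measurable_fun.
have dFx x : derivable F x 1 by have [] := dF x.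
have cF x : {for x, continuous F}.
  by apply: differentiable_continuous; apply/derivable1_diffP.
have intD n : (\int[mu]_(x in D n) (f x)%:E
    = (F n.+1%:R - F (- n.+1%:R))%:E)%E.
  have n0 : - n.+1%:R < n.+1%:R :> R.
    by rewrite (lt_trans (y := 0)) // ?oppr_lt0 ?ltr0n.
  rewrite EFinB; apply: continuous_FTC2 => //.
  - exact: continuous_subspaceT.
  - split => //.
    + exact: cvg_at_right_filter (cF _).
    + exact: cvg_at_left_filter (cF _).
  - by move=> x _; rewrite derive1E; have [_ ->] := dF x.
have mEf : measurable_fun setT (EFin \o f) by exact/measurable_EFinP.
have H1 n : measurable_fun setT ((EFin \o f) \_ (D n)).
  apply/(measurable_restrictT _ (mD n)).
  exact: measurable_funTS mEf.
have H2 : {ae mu, forall x, setT x ->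
    ((EFin \o f) \_ (D n)) x @[n --> \oo] --> (EFin \o f) x}.
  apply: aeW => x _; apply: cvg_near_cst.
  have [k kx] : exists k : nat, `|x| <= k%:R.
    exists (Num.bound `|x|); apply: ltW; exact: archi_boundP.
  exists k => // n /= kn; rewrite patchE ifT // inE /D /= in_itv /= -ler_norml.
  by rewrite (le_trans kx) // ler_nat (leq_trans kn).
have H3 : {ae mu, forall x n, setT x ->
    (`|((EFin \o f) \_ (D n)) x| <= `|(EFin \o f) x|)%E}.
  by apply: aeW => x k _; rewrite patchE; case: ifPn => // _; rewrite abse0.
have [_ _ H] := @dominated_convergence _ _ _ mu setT measurableT
  _ _ _ H1 mEf H2 (integrable_abse intf) H3.
have {}H : (F n.+1%:R - F (- n.+1%:R))%:E @[n --> \oo]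
    --> (\int[mu]_x (f x)%:E)%E.
  move: H; rewrite (_ : [sequence _]_n =
    fun n => (F n.+1%:R - F (- n.+1%:R))%:E) //; apply/funext => n /=.
  by rewrite -integral_mkcond intD.
have nS : n.+1 @[n --> \oo] --> \oo.
  by apply/cvgnyPgt => k; exists k => // n /= kn; rewrite ltnS.
have lim0 := cvg_comp _ _ (cvg_comp _ _ nS (@cvgr_idn R)) Fl.
have lim1 : (F n.+1%:R - F (- n.+1%:R))%:E @[n --> \oo] --> l%:E.
  by apply: cvg_EFin; [exact: nearW | exact: lim0].
by rewrite /Rintegral (cvg_unique _ H lim1).
Qed.

Definition cintegrable f :=
  (@lebesgue_measure R).-integrable setT (fun x => (Re (f x))%:E) /\
  (@lebesgue_measure R).-integrable setT (fun x => (Im (f x))%:E).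

Lemma integralC_pv f l : ccontinuous f -> cintegrable f -> pv_integral f l ->
  integralC f = l.
Proof.
move=> [c1 c2] [i1 i2] [F dF [Fl1 Fl2]]; apply: complex_eq => /=.
  apply: (FTC_line c1 _ i1) => [x|]; first by have [] := dF x; eauto.
  move: Fl1; under eq_fun do rewrite cReD cReN; exact.
apply: (FTC_line c2 _ i2) => [x|]; first by have [] := dF x; eauto.
move: Fl2; under eq_fun do rewrite cImD cImN; exact.
Qed.

End ComplexValuedCalculus.

(** * The integral of 1 / (s - a) along the imaginary axis *)

Section ResolventIntegrals.
Local Notation Re := complex.Re.
Local Notation Im := complex.Im.
Local Notation "z ^*" := (conjc z) : ring_scope.
Local Open Scope classical_set_scope.
Variable R : realType.
Local Notation C := R[i].
Implicit Types (f g F : R -> C) (z l a mu : C).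

Definition resolvent a (w : R) : C := (0 +i* w - a)^-1.

Lemma cReV z : Re z^-1 = Re z / (Re z ^+ 2 + Im z ^+ 2).
Proof. by case: z. Qed.

Lemma cImV z : Im z^-1 = - Im z / (Re z ^+ 2 + Im z ^+ 2).
Proof. by case: z => a b /=; rewrite mulNr. Qed.

Lemma resolvent_axis_neq0 a (w : R) : Re a < 0 -> 0 +i* w - a != 0.
Proof.
move=> a0; apply/eqP => /(congr1 (@complex.Re _)); rewrite cReD cReN /=; lra.
Qed.

Lemma denom_resolvent_gt0 a (w : R) : Re a < 0 -> 0 < Re a ^+ 2 + (w - Im a) ^+ 2.
Proof. by move=> a0; rewrite ltr_pwDl ?sqr_ge0 // exprn_even_gt0 //= lt_eqF. Qed.

Lemma Re_resolvent a w : Re (resolvent a w) = - Re a / (Re a ^+ 2 + (w - Im a) ^+ 2).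
Proof. by rewrite cReV !cReD !cReN !cImD !cImN /= add0r sqrrN. Qed.

Lemma Im_resolvent a w :
  Im (resolvent a w) = - (w - Im a) / (Re a ^+ 2 + (w - Im a) ^+ 2).
Proof. by rewrite cImV !cReD !cReN !cImD !cImN /= add0r sqrrN. Qed.

Lemma is_derive_affine (b c x : R) : is_derive x 1 (fun t : R => (t - b) / c) c^-1.
Proof.
apply: is_derive_eq (is_deriveM
  (is_deriveB (is_derive_id x (1:R)) (is_derive_cst b x (1:R)))
  (is_derive_cst c^-1 x (1:R))) _.
by rewrite /GRing.scale /= mulr0 subr0 add0r mulr1.
Qed.

Lemma is_derive_sqrD (b c x : R) :
  is_derive x 1 (fun t : R => c + (t - b) ^+ 2) (2 * (x - b)).
Proof.
have h := is_deriveX 2 (is_deriveB (is_derive_id x (1:R)) (is_derive_cst b x (1:R))).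
apply: is_derive_eq (is_deriveD (is_derive_cst c x (1:R)) h) _.
by rewrite /GRing.scale /= add0r subr0 mulr1 expr1.
Qed.

Lemma cvgy_affine (b c : R) : 0 < c -> (t - b) / c @[t --> +oo] --> +oo.
Proof.
move=> c0; apply/cvgryPge => A; near=> t.
rewrite ler_pdivlMr // lerBrDr; near: t; apply: nbhs_pinfty_ge; exact: num_real.
Unshelve. all: by end_near. Qed.

Lemma eq_cvgy (u v : R -> R) (l : R) : u =1 v ->
  u w @[w --> +oo] --> l -> v w @[w --> +oo] --> l.
Proof. by move=> /funext ->. Qed.

(** With u = w - Im a, both coordinates of 1 / (i w - a) are bounded by 1 / u,
    because u and |Re a| are both at most (Re a ^ 2 + u ^ 2) / u for u > 0. *)
Lemma resolvent_cvg0 a : Re a < 0 -> ccvgy (resolvent a) 0.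
Proof.
move=> a0.
have pos : \forall w \near +oo, 0 < w - Im a.
  near=> w; rewrite subr_gt0; near: w; apply: nbhs_pinfty_gt; exact: num_real.
have inv0 : (w - Im a)^-1 @[w --> +oo] --> (0 : R).
  apply/gtr0_cvgV0 => //; have := @cvgy_affine (Im a) 1 ltr01.
  by under eq_fun do rewrite divr1.
split; rewrite /=.
  apply: (@squeeze_cvgr _ _ _ _ (cst 0) (fun w => (w - Im a)^-1)) => //;
    last exact: cvg_cst.
  near=> w; rewrite Re_resolvent.
  have d0 := denom_resolvent_gt0 w a0.
  have : 0 < w - Im a by near: w.
  move: d0; set u := w - Im a => d0 u0; apply/andP; split.
    by rewrite divr_ge0 // ltW // oppr_gt0.
  rewrite ler_pdivrMr // mulrC ler_pdivlMr //; nra.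
apply: (@squeeze_cvgr _ _ _ _ (fun w => - (w - Im a)^-1) (cst 0)) => //;
  last 2 first.
- by rewrite -oppr0; exact: cvgN.
- exact: cvg_cst.
near=> w; rewrite Im_resolvent.
have d0 := denom_resolvent_gt0 w a0.
have : 0 < w - Im a by near: w.
move: d0; set u := w - Im a => d0 u0; apply/andP; split; last first.
  by rewrite mulNr oppr_le0 divr_ge0 // ltW.
rewrite mulNr lerN2 ler_pdivrMr // mulrC ler_pdivlMr //; nra.
Unshelve. all: by end_near. Qed.

(** The real part is the density of a rescaled arctangent, which grows by pi
    in total.  The imaginary part is not integrable, but its logarithmic
    primitive takes nearly the same values at w and - w, so it does not
    contribute to the symmetric limit. *)
Lemma pv_resolvent a : Re a < 0 -> pv_integral (resolvent a) (pi : R)%:C.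
Proof.
move=> a0; have d0 w := denom_resolvent_gt0 w a0.
have a'0 : 0 < - Re a by lra.
exists (fun w => atan ((w - Im a) / - Re a)
  +i* (- 2^-1 * ln (Re a ^+ 2 + (w - Im a) ^+ 2))).
  move=> x; split => /=.
    apply: is_derive_eq (is_derive1_comp (is_derive1_atan _)
      (is_derive_affine (Im a) (- Re a) x)) _.
    rewrite Re_resolvent.
    have := d0 x; set u := x - _ => u0.
    field.
    by apply/andP; split; [exact: lt0r_neq0 | exact: ltr0_neq0].
  have dln := @is_derive1_comp _ (@ln R) (fun t => Re a ^+ 2 + (t - Im a) ^+ 2)
    x _ _ (is_derive1_ln (d0 x)) (is_derive_sqrD (Im a) (Re a ^+ 2) x).
  have h := is_deriveM (is_derive_cst (- 2^-1 : R) x (1 : R)) dln.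
  apply: is_derive_eq h _.
  rewrite Im_resolvent /GRing.scale /=.
  have := d0 x; set u := x - _ => u0; field; lra.
split => /=.
  have l1 := cvg_comp _ _ (cvgy_affine (Im a) a'0) (@cvgy_atan R).
  have l2 := cvg_comp _ _ (cvgy_affine (- Im a) a'0) (@cvgy_atan R).
  (* By parity of atan, the value at - w is minus the one at w for the
     opposite shift. *)
  rewrite (splitr pi); apply: eq_cvgy (cvgD l1 l2) => w /=.
  rewrite -[in RHS]atanN; congr (_ + atan _); field; lra.
(* The logarithms combine into that of a quotient which differs from 1 by a
   linear combination of the coordinates of r w, hence tends to 1. *)
pose r w := resolvent a^* w.
have rJ : ccvgy r 0 by apply: resolvent_cvg0; rewrite cReJ.
have lim1 : 1 + 4 * Im a * (Im (r w) + Im a * (Re (r w) / - Re a)) @[w --> +oo]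
    --> (1 : R).
  have [r1 r2] := rJ.
  have := cvgD (cvg_cst (1 : R)) (cvgM (cvg_cst (4 * Im a))
    (cvgD r2 (cvgM (cvg_cst (Im a)) (cvgM r1 (cvg_cst (- Re a)^-1))))).
  by rewrite /= !(mul0r, mulr0, addr0); exact.
have lim2 := cvg_comp _ _ lim1 (continuous_ln ltr01).
rewrite -(mulr0 (- 2^-1)) -ln1.
apply: eq_cvgy (cvgM (cvg_cst (- 2^-1 : R)) lim2) => w /=.
rewrite -mulrBr; congr (_ * _).
have d1 := d0 w; have d2 := d0 (- w).
rewrite -ln_div ?posrE //; congr ln.
rewrite /r Im_resolvent Re_resolvent cReJ cImJ opprK.
have -> : (w + Im a) ^+ 2 = (- w - Im a) ^+ 2 by ring.
field.
by apply/andP; split; [exact: lt0r_neq0 | exact: ltr0_neq0].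
Qed.

End ResolventIntegrals.

(** * Products of simple fractions and the Cauchy formula *)

Section ResolventPowers.
Local Notation Re := complex.Re.
Local Notation Im := complex.Im.
Local Notation "z ^*" := (conjc z) : ring_scope.
Variable R : realType.
Local Notation C := R[i].
Implicit Types (z l a mu : C) (L : seq C).

Lemma cderivative_resolvent a : Re a < 0 ->
  cderivative (resolvent a) (fun w => - 'i * resolvent a w ^+ 2).
Proof.
move=> a0 x; have d0 := denom_resolvent_gt0 x a0.
pose d (t : R) := Re a ^+ 2 + (t - Im a) ^+ 2.
have dV : is_derive x 1 (fun t => (d t)^-1) (- d x ^- 2 * (2 * (x - Im a))).
  have := @is_deriveV _ d x _ 1 (lt0r_neq0 d0) (is_derive_sqrD (Im a) (Re a ^+ 2) x).
  exact.
have dA := is_deriveN (is_deriveB (is_derive_id x (1 : R))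
  (is_derive_cst (Im a) x (1 : R))).
have D0 := lt0r_neq0 d0.
split.
  under eq_fun do rewrite Re_resolvent -/(d _).
  apply: is_derive_eq (is_deriveM (is_derive_cst (- Re a) x (1 : R)) dV) _.
  rewrite expr2 !(cReM, cImM) Re_resolvent Im_resolvent -/(d x) /GRing.scale /=.
  by rewrite /d; field.
under eq_fun do rewrite Im_resolvent -/(d _).
have h := is_deriveM dA dV.
apply: (@is_derive_eq _ _ _ _ _ _ _ _ h).
rewrite expr2 !(cReM, cImM) Re_resolvent Im_resolvent -/(d x) /GRing.scale /=.
rewrite -[(- _) x]/(- (x - Im a)).
by rewrite /d; field.
Qed.

Lemma cderivative_resolventX a k : Re a < 0 ->
  cderivative (fun w => resolvent a w ^+ k)
    (fun w => - 'i * k%:R * resolvent a w ^+ k.+1).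
Proof.
move=> a0; elim: k => [|k ih].
  have := cderivative_cst (1 : C); congr cderivative; apply/funext => w.
  by rewrite mulr0 mul0r.
have := cderivativeM (cderivative_resolvent a0) ih.
congr cderivative; apply/funext => w; rewrite ?exprS //; ring.
Qed.

(** Reflecting the imaginary axis amounts to complex conjugation; this turns
    limits at - oo into limits at + oo. *)
Lemma resolventJ a w : resolvent a (- w) = (resolvent a^* w)^*.
Proof.
rewrite /resolvent conjc_inv; congr _^-1.
by apply: complex_eq;
  rewrite !(cReJ, cImJ, cReD, cImD, cReN, cImN) /=; ring.
Qed.

Lemma resolventX_cvg0 a k : Re a < 0 -> ccvgy (fun w => resolvent a w ^+ k.+1) 0.
Proof.
move=> a0; elim: k => [|k ih]; first exact: resolvent_cvg0.
by have := ccvgyM (resolvent_cvg0 a0) ih; rewrite mul0r.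
Qed.

(** A power of order at least two has a primitive that is again a power and
    vanishes at both ends of the axis. *)
Lemma pv_resolventX a k : Re a < 0 -> pv_integral (fun w => resolvent a w ^+ k.+2) 0.
Proof.
move=> a0.
have i0 : ('i : C) != 0 by rewrite eq_complex /= oner_eq0 andbF.
have k0 : k.+1%:R != 0 :> C by rewrite pnatr_eq0.
(* The factor is the one produced by differentiating the power k.+1. *)
suff : pv_integral (fun w => - 'i * k.+1%:R * resolvent a w ^+ k.+2) 0.
  move=> /(pv_integralZ (- 'i * k.+1%:R)^-1); rewrite mulr0.
  apply: eq_pv_integral => w; rewrite mulKf // mulf_neq0 // oppr_eq0 //.
exists (fun w => resolvent a w ^+ k.+1); first exact: cderivative_resolventX.
have aJ : Re a^* < 0 by rewrite cReJ.
have h1 := resolventX_cvg0 k a0.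
have h2 := ccvgyM (ccvgy_cst (-1)) (ccvgyJ (resolventX_cvg0 k aJ)).
have := ccvgyD h1 h2; rewrite add0r conjc0 mulr0; congr ccvgy.
by apply/funext => w; rewrite mulN1r resolventJ rmorphXn.
Qed.

Definition stable_poles L := all (fun a => Re a < 0) L.

Lemma resolvent_partial_fraction a b w : Re a < 0 -> Re b < 0 -> a != b ->
  resolvent a w * resolvent b w = (a - b)^-1 * (resolvent a w + - 1 * resolvent b w).
Proof.
move=> a0 b0 ab; rewrite /resolvent.
have := resolvent_axis_neq0 w a0; have := resolvent_axis_neq0 w b0.
have ab0 : a - b != 0 by rewrite subr_eq0.
move: (0 +i* w) => s sa sb; field; rewrite ?sa ?sb ?ab0 //.
Qed.

(** For two factors or more the value is 0, as closing the contour on the right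
    predicts.  If all poles coincide, the integrand is a power.  Otherwise
    a partial fraction on two distinct poles a and b yields a difference of
    two products with one factor less; these have equal values, either 0 or,
    when a single factor is left, pi. *)
Lemma pv_resolvent_prod L : stable_poles L -> L != [::] ->
  pv_integral (fun w => \prod_(a <- L) resolvent a w)
    (if size L == 1%N then (pi : R)%:C else 0).
Proof.
move: {2}(size L) (leqnn (size L)) => n.
elim: n L => [|n ih] L; first by case: L.
case: L => [//|a L] /= sL /andP[a0 LL] _.
case: (boolP (all (pred1 a) L)) => [aL|].
  have -> : L = nseq (size L) a by apply/all_pred1P.
  have prodE w : \prod_(b <- a :: nseq (size L) a) resolvent b w
      = resolvent a w ^+ (size L).+1.
    by rewrite big_cons exprS; congr (_ * _); elim: (size L) => [|k IH] /=;
      rewrite ?big_nil // big_cons IH exprS.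
  apply: eq_pv_integral (fun w => esym (prodE w)) _.
  rewrite size_nseq; case: (size L) => [|k]; first exact: pv_resolvent.
  exact: pv_resolventX.
move=> /allPn[b bL /= nba].
have b0 : Re b < 0 by have /allP := LL; apply.
have pL : perm_eq L (b :: rem b L) by exact: perm_to_rem.
have szL : size L = (size (rem b L)).+1 by rewrite (perm_size pL).
set L' := rem b L in pL szL.
have LL' : stable_poles L'.
  by move: LL; rewrite /stable_poles (perm_all _ pL) /= => /andP[].
have E w : \prod_(c <- a :: L) resolvent c w = (a - b)^-1 *
    (\prod_(c <- a :: L') resolvent c w + - 1 * \prod_(c <- b :: L') resolvent c w).
  rewrite !big_cons (perm_big _ pL) /= big_cons mulrA.
  by rewrite resolvent_partial_fraction // 1?eq_sym //; ring.
apply: eq_pv_integral (fun w => esym (E w)) _.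
rewrite szL eqSS.
have iha := ih (a :: L') _ _ isT; have ihb := ih (b :: L') _ _ isT.
have := pv_integralZ (a - b)^-1 (pv_integralD (iha _ _) (pv_integralZ (- 1) (ihb _ _))).
rewrite /= mulN1r subrr mulr0; apply.
- by rewrite -szL.
- by rewrite /= a0.
- by rewrite -szL.
- by rewrite /= b0.
Qed.

(** The Cauchy formula for a product of simple fractions.  The identity
    1 / ((s - a) (mu - s)) = (1 / (s - a) + 1 / (mu - s)) / (mu - a) removes
    the factor at a: its first term is covered by [pv_resolvent_prod] and its
    second by induction.  With one factor left both terms contribute pi, hence
    the constant 2 pi. *)
Lemma pv_prod_pole L mu : stable_poles L -> L != [::] -> 0 < Re mu ->
  pv_integral (fun w => \prod_(a <- L) resolvent a w * (mu - 0 +i* w)^-1)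
    (2 * (pi : R)%:C * \prod_(a <- L) (mu - a)^-1).
Proof.
move=> LL L0 mu0; elim: L LL L0 => [//|a L ih] /= /andP[a0 LL] _.
have mua : mu - a != 0.
  by apply/eqP => /(congr1 (@complex.Re _)); rewrite cReD cReN /=; lra.
have pL := @pv_resolvent_prod (a :: L) _ isT.
have E w : (mu - a)^-1 * (\prod_(b <- a :: L) resolvent b w
     + \prod_(b <- L) resolvent b w * (mu - 0 +i* w)^-1)
    = \prod_(b <- a :: L) resolvent b w * (mu - 0 +i* w)^-1.
  rewrite big_cons /resolvent.
  have sa := resolvent_axis_neq0 w a0.
  have muw : mu - 0 +i* w != 0.
    by apply/eqP => /(congr1 (@complex.Re _)); rewrite cReD cReN /=; lra.
  move: (\prod_(_ <- _) _) => p.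
  move: (0 +i* w) sa muw => s sa muw; field; by rewrite mua sa muw.
apply: eq_pv_integral E _; rewrite big_cons.
case: L LL ih pL => [|b L] LL ih pL.
  have pmu : pv_integral (fun w => (mu - 0 +i* w)^-1) (pi : R)%:C.
    have nmu : Re (- mu^*) < 0 by rewrite cReN cReJ; lra.
    have := pv_integralJ (pv_resolvent nmu); rewrite conjc_real.
    apply: eq_pv_integral => w; rewrite /resolvent conjc_inv; congr _^-1.
    apply: complex_eq; rewrite !(cReJ, cImJ, cReD, cImD, cReN, cImN) /=; ring.
  have := pv_integralZ (mu - a)^-1 (pv_integralD (pL _) pmu).
  rewrite /= !big_nil a0 => /(_ isT); congr pv_integral; last by ring.
  by apply/funext => w; rewrite !big_nil mul1r.
have := pv_integralZ (mu - a)^-1 (pv_integralD (pL _) (ih LL isT)).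
rewrite /= a0 => /(_ LL); rewrite add0r; congr pv_integral; ring.
Qed.

End ResolventPowers.

(** * Stable strictly proper rational functions *)

Section StableStrictlyProper.
Local Notation Re := complex.Re.
Local Notation Im := complex.Im.
Local Notation "z ^*" := (conjc z) : ring_scope.
Variable R : realType.
Local Notation C := R[i].
Local Notation "x %:F" := (tofrac x).
Implicit Types (f g : ratfun R) (z c s a mu : C) (L : seq C) (n : {poly C}).

Definition pole_poly L : {poly C} := \prod_(a <- L) ('X - a%:P).

(** Stable and strictly proper: all poles are in the open left half-plane, and
    the size condition says that the numerator has degree less than the
    denominator.  The two may share roots, so that sums need no reduction. *)
Definition stable_sp f := exists n L,
  [/\ stable_poles L, (size n <= size L)%N & f = n%:F / (pole_poly L)%:F].

(** Field identities are stated over an abstract field, since normalizing terms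
    in the fraction field itself would unfold the quotient construction. *)
Lemma addf_divZ (K : fieldType) (c n1 p1 n2 p2 : K) : p1 != 0 -> p2 != 0 ->
  c * (n1 / p1) + n2 / p2 = (c * n1 * p2 + n2 * p1) / (p1 * p2).
Proof. by move=> p10 p20; field; rewrite p10 p20. Qed.

Lemma divf_newton (K : fieldType) (u d c p : K) : d != 0 -> p != 0 ->
  (u * d + c) / (d * p) = c * (1 / (d * p)) + u / p.
Proof. by move=> d0 p0; field; rewrite d0 p0. Qed.

Lemma pole_poly_neq0 L : pole_poly L != 0.
Proof. by rewrite monic_neq0 // monic_prod_XsubC. Qed.

Lemma horner_pole_poly L s : (pole_poly L).[s] = \prod_(a <- L) (s - a).
Proof. by rewrite horner_prod; apply: eq_bigr => a _; rewrite hornerXsubC. Qed.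

Lemma pole_poly_rhp_neq0 L s : stable_poles L -> 0 <= Re s -> (pole_poly L).[s] != 0.
Proof.
move=> LL s0; rewrite horner_pole_poly prodf_seq_neq0; apply/allP => a aL /=.
have /allP/(_ _ aL) := LL; apply: contraTneq => /eqP; rewrite subr_eq0.
by move=> /eqP <-; rewrite -leNgt.
Qed.

Lemma rat_eval_stable n L s : stable_poles L -> 0 <= Re s ->
  rat_eval (n%:F / (pole_poly L)%:F) s = n.[s] / \prod_(a <- L) (s - a).
Proof.
by move=> LL s0; rewrite rat_evalE ?pole_poly_rhp_neq0 // horner_pole_poly.
Qed.

Lemma rat_eval0 s : rat_eval (0 : ratfun R) s = 0.
Proof.
have := @rat_evalE R 0 1 s; rewrite tofrac0 mul0r horner0 hornerC mul0r.
by apply; rewrite oner_neq0.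
Qed.

Lemma stable_sp0 : stable_sp 0.
Proof. by exists 0, [::]; split; rewrite ?size_poly0 // tofrac0 mul0r. Qed.

(** The two conclusions share the computation of a common denominator. *)
Lemma stable_sp_linear c f g : stable_sp f -> stable_sp g ->
  stable_sp (rat_cst c * f + g) /\ forall s, 0 <= Re s ->
    rat_eval (rat_cst c * f + g) s = c * rat_eval f s + rat_eval g s.
Proof.
move=> [n1 [L1 [L1s n1L1 ->]]] [n2 [L2 [L2s n2L2 ->]]].
have p1 := pole_poly_neq0 L1; have p2 := pole_poly_neq0 L2.
have L12s : stable_poles (L1 ++ L2) by rewrite /stable_poles all_cat; apply/andP.
have E : rat_cst c * (n1%:F / (pole_poly L1)%:F) + n2%:F / (pole_poly L2)%:F
   = (c *: n1 * pole_poly L2 + n2 * pole_poly L1)%:F / (pole_poly (L1 ++ L2))%:F.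
  rewrite /pole_poly big_cat -!/(pole_poly _) /= -mul_polyC !(tofracD, tofracM).
  by rewrite addf_divZ // tofrac_eq0.
rewrite {}E; split; last first.
  move=> s s0; rewrite !rat_eval_stable // big_cat /=.
  rewrite hornerD !hornerM hornerZ !horner_pole_poly addf_divZ //.
    by have := pole_poly_rhp_neq0 L1s s0; rewrite horner_pole_poly.
  by have := pole_poly_rhp_neq0 L2s s0; rewrite horner_pole_poly.
exists (c *: n1 * pole_poly L2 + n2 * pole_poly L1), (L1 ++ L2); split => //.
rewrite size_cat (leq_trans (size_polyD _ _)) // geq_max; apply/andP; split.
  rewrite (leq_trans (size_polyMleq _ _)) // size_prod_XsubC addnS /=.
  by rewrite leq_add2r (leq_trans (size_scale_leq _ _)).
rewrite (leq_trans (size_polyMleq _ _)) // size_prod_XsubC addnS /= addnC.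
by rewrite leq_add2l.
Qed.

Lemma stable_sp_pole_poly L : stable_poles L -> L != [::] ->
  stable_sp (1 / (pole_poly L)%:F).
Proof.
move=> LL L0; exists 1, L; split=> //; rewrite ?tofrac1 //.
by rewrite size_poly1 lt0n size_eq0.
Qed.

(** Newton's form of the numerator: dividing it by one linear factor of the
    denominator at a time writes the fraction as a combination of the
    reciprocals of partial products of the denominator, whether or not poles
    are repeated. *)
Lemma stable_sp_ind (P : ratfun R -> Prop) :
  P 0 ->
  (forall c f g, stable_sp f -> stable_sp g -> P f -> P g -> P (rat_cst c * f + g)) ->
  (forall L, stable_poles L -> L != [::] -> P (1 / (pole_poly L)%:F)) ->
  forall f, stable_sp f -> P f.
Proof.
move=> P0 PD PL f [n [L [+ + ->]]] {f}.
elim: L n => [|a L ih] n LL sn.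
  by move: sn; rewrite leqn0 size_poly_eq0 => /eqP ->; rewrite tofrac0 mul0r.
have LL' : stable_poles L by move: LL => /= /andP[].
have sn' : (size (n %/ ('X - a%:P))%R <= size L)%N.
  by rewrite size_divp ?polyXsubC_eq0 // size_XsubC /= leq_subLR.
have -> : n%:F / (pole_poly (a :: L))%:F =
    rat_cst n.[a] * (1 / (pole_poly (a :: L))%:F) + (n %/ ('X - a%:P))%:F / (pole_poly L)%:F.
  rewrite {1}(divp_eq n ('X - a%:P)) modp_XsubC /rat_cst.
  rewrite /pole_poly big_cons -/(pole_poly _).
  have : 'X - a%:P != 0 by rewrite polyXsubC_eq0.
  move: ('X - a%:P) => d d0; rewrite !(tofracD, tofracM).
  by rewrite divf_newton // tofrac_eq0 ?pole_poly_neq0.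
apply: PD.
- exact: stable_sp_pole_poly.
- by exists (n %/ ('X - a%:P)), L; split.
- exact: PL.
- exact: ih.
Qed.

Lemma rat_eval_pole_poly L s : stable_poles L -> 0 <= Re s ->
  rat_eval (1 / (pole_poly L)%:F) s = \prod_(a <- L) (s - a)^-1.
Proof.
move=> LL s0; rewrite -tofrac1 rat_eval_stable // hornerC mul1r.
by rewrite (big_morph _ (@invfM C) (@invr1 C)).
Qed.

Definition axis f (w : R) : C := rat_eval f (0 +i* w).

Lemma axis0 : axis 0 = fun=> 0. Proof. by apply/funext => w; exact: rat_eval0. Qed.

Lemma axis_linear c f g : stable_sp f -> stable_sp g ->
  axis (rat_cst c * f + g) = fun w => c * axis f w + axis g w.
Proof.
by move=> sf sg; apply/funext => w; have [_] := stable_sp_linear c sf sg; apply.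
Qed.

Lemma axis_pole_poly L : stable_poles L ->
  axis (1 / (pole_poly L)%:F) = fun w => \prod_(a <- L) resolvent a w.
Proof. by move=> LL; apply/funext => w; rewrite /axis rat_eval_pole_poly. Qed.

Lemma ccontinuous_resolvent a : Re a < 0 -> ccontinuous (resolvent a).
Proof.
move=> a0; have d := cderivative_resolvent a0.
by split => x; apply: differentiable_continuous; apply/derivable1_diffP;
  have [[] + _ []] := d x.
Qed.

Lemma ccontinuous_axis f : stable_sp f -> ccontinuous (axis f).
Proof.
move: f; apply: stable_sp_ind => [|c f g sf sg cf cg|L LL _].
- by rewrite axis0; exact: ccontinuous_cst.
- rewrite axis_linear //; apply: ccontinuousD => //.
  by apply: ccontinuousM => //; exact: ccontinuous_cst.
- rewrite axis_pole_poly //; elim: L LL => [_|a L ih /= /andP[a0 LL]].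
    by under eq_fun do rewrite big_nil; exact: ccontinuous_cst.
  under eq_fun do rewrite big_cons; apply: ccontinuousM (ih LL).
  exact: ccontinuous_resolvent.
Qed.

(** Both sides are linear in [f], so the Cauchy formula for products of simple
    fractions extends to all stable strictly proper functions. *)
Lemma pv_axis_pole f mu : stable_sp f -> 0 < Re mu ->
  pv_integral (fun w => axis f w * (mu - 0 +i* w)^-1) (2 * (pi : R)%:C * rat_eval f mu).
Proof.
move=> + mu0; move: f; apply: stable_sp_ind => [|c f g sf sg If Ig|L LL L0].
- rewrite axis0 rat_eval0 mulr0; apply: eq_pv_integral (fun w => esym (mul0r _)) _.
  exists (fun=> 0); first exact: cderivative_cst.
  by under eq_fun do rewrite subrr; exact: ccvgy_cst.
- have [_ ->] := stable_sp_linear c sf sg; last exact: ltW.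
  have := pv_integralD (pv_integralZ c If) Ig; rewrite axis_linear //.
  by congr pv_integral; [apply/funext => w|]; ring.
- rewrite axis_pole_poly // rat_eval_pole_poly // 1?ltW //.
  exact: pv_prod_pole.
Qed.

Definition sqnorm z : R := Re z ^+ 2 + Im z ^+ 2.

Lemma sqnorm_ge0 z : 0 <= sqnorm z.
Proof. by rewrite addr_ge0 ?sqr_ge0. Qed.

Lemma sqnormM z a : sqnorm (z * a) = sqnorm z * sqnorm a.
Proof. by rewrite /sqnorm cReM cImM; ring. Qed.

Lemma sqnormD z a : sqnorm (z + a) <= 2 * (sqnorm z + sqnorm a).
Proof.
rewrite /sqnorm cReD cImD.
have := sqr_ge0 (Re z - Re a); have := sqr_ge0 (Im z - Im a); lra.
Qed.

Lemma sqnorm_resolvent a w : Re a < 0 ->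
  sqnorm (resolvent a w) * (1 + w ^+ 2) <= 2 + (1 + 2 * Im a ^+ 2) / Re a ^+ 2.
Proof.
move=> a0; have d0 := denom_resolvent_gt0 w a0.
rewrite /sqnorm Re_resolvent Im_resolvent.
rewrite !expr_div_n !sqrrN -mulrDl expr2 invfM mulrA divff ?lt0r_neq0 // mul1r.
rewrite mulrC ler_pdivrMr //.
have a2 : 0 < Re a ^+ 2 by rewrite exprn_even_gt0 //= lt_eqF.
set k := (1 + 2 * Im a ^+ 2) / Re a ^+ 2.
have k0 : 0 <= k.
  by apply: divr_ge0 (ltW a2); rewrite addr_ge0 // mulr_ge0 // sqr_ge0.
have kE : k * Re a ^+ 2 = 1 + 2 * Im a ^+ 2 by rewrite divfK // lt0r_neq0.
have := mulr_ge0 k0 (sqr_ge0 (w - Im a)).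
(* This square yields w ^ 2 <= 2 (w - Im a) ^ 2 + 2 (Im a) ^ 2. *)
have := sqr_ge0 (w - 2 * Im a).
rewrite mulrDr !mulrDl kE; move: (k * _ ^+ 2) => t; nra.
Qed.

(** On the imaginary axis such a function is O(1 / |w|); this is what makes
    products of two of them integrable. *)
Lemma axis_bound f : stable_sp f ->
  exists K : R, forall w, sqnorm (axis f w) * (1 + w ^+ 2) <= K.
Proof.
have w1 (w : R) : 1 <= 1 + w ^+ 2 by rewrite lerDl sqr_ge0.
move: f; apply: stable_sp_ind => [|c f g sf sg [K1 h1] [K2 h2]|L LL L0].
- by exists 0 => w; rewrite axis0 /sqnorm /= expr0n /= addr0 mul0r.
- exists (2 * (sqnorm c * K1 + K2)) => w; rewrite axis_linear //.
  have := ler_wpM2r (le_trans ler01 (w1 w)) (sqnormD (c * axis f w) (axis g w)).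
  move=> /le_trans; apply; rewrite -mulrA ler_pM2l // mulrDl sqnormM -mulrA.
  by apply: lerD => //; apply: ler_wpM2l => //; exact: sqnorm_ge0.
- rewrite axis_pole_poly //; case: L L0 LL => // a L _ /= /andP[a0 LL].
  elim: L LL a a0 => [_|b L ih /= /andP[b0 LL]] a a0.
    exists (2 + (1 + 2 * Im a ^+ 2) / Re a ^+ 2) => w.
    by rewrite big_seq1; exact: sqnorm_resolvent.
  have [K hK] := ih LL b b0.
  set k := 2 + (1 + 2 * Im a ^+ 2) / Re a ^+ 2.
  exists (k * K) => w; rewrite big_cons sqnormM -mulrA.
  apply: ler_pM (hK w); rewrite ?mulr_ge0 ?sqnorm_ge0 ?(le_trans _ (w1 w)) //.
  have := sqnorm_resolvent w a0; apply: le_trans.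
  by rewrite ler_peMr ?sqnorm_ge0.
Qed.

Lemma integrable_oneDsqrV :
  (@lebesgue_measure R).-integrable setT (fun w : R => ((1 + w ^+ 2)^-1)%:E).
Proof.
have m : measurable_fun setT (fun w : R => ((1 + w ^+ 2)^-1)%:E).
  by apply/measurable_EFinP; apply: continuous_measurable_fun;
    exact: continuous_oneDsqrV.
apply/integrableP; split => //.
have pos (w : R) : 0 <= (1 + w ^+ 2)^-1 by rewrite invr_ge0 addr_ge0 // sqr_ge0.
under eq_integral do rewrite gee0_abs ?lee_fin //.
rewrite ge0_symfun_integralT //.
- have := @integral0y_oneDsqr R; rewrite set_itvcy => ->.
  by rewrite -EFinM ltry.
- exact: continuous_oneDsqrV.
- by move=> w /=; rewrite sqrrN.
Qed.

Lemma normr_dot2_le (x y u v : R) :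
  `|x * u + y * v| * 2 <= x ^+ 2 + y ^+ 2 + (u ^+ 2 + v ^+ 2).
Proof.
have := sqr_ge0 (x - u); have := sqr_ge0 (y - v).
have := sqr_ge0 (x + u); have := sqr_ge0 (y + v).
by case: (ler0P (x * u + y * v)) => _; nra.
Qed.

Lemma cintegrable_axisM f g : stable_sp f -> stable_sp g ->
  cintegrable (fun w => axis f w * (axis g w)^*).
Proof.
move=> sf sg; have [K1 h1] := axis_bound sf; have [K2 h2] := axis_bound sg.
have [c1 c2] := ccontinuousM (ccontinuous_axis sf)
  (ccontinuousJ (ccontinuous_axis sg)).
have dom : (@lebesgue_measure R).-integrable setT
    (fun w : R => ((K1 + K2) * (1 + w ^+ 2)^-1)%:E).
  have := integrableZl measurableT (K1 + K2) integrable_oneDsqrV.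
  by under eq_fun do rewrite -EFinM.
have bound (w x : R) : `|x| * 2 <= sqnorm (axis f w) + sqnorm (axis g w) ->
    (`|x%:E| <= `|((K1 + K2) * (1 + w ^+ 2)^-1)%:E|)%E.
  move=> xw; rewrite lee_fin; apply: le_trans (ler_norm _).
  rewrite ler_pdivlMr ?ltr_pwDl ?sqr_ge0 //.
  have := h1 w; have := h2 w; have := normr_ge0 x; have := sqr_ge0 w.
  have := sqnorm_ge0 (axis f w); have := sqnorm_ge0 (axis g w).
  move: (sqnorm _) (sqnorm _) (w ^+ 2) `|x| xw => u v t y; nra.
split.
  apply: le_integrable dom => //.
    by apply/measurable_EFinP; exact: continuous_measurable_fun.
  move=> w _; apply: bound; rewrite cReM cReJ cImJ /sqnorm.
  by rewrite mulrN opprK; exact: normr_dot2_le.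
apply: le_integrable dom => //.
  by apply/measurable_EFinP; exact: continuous_measurable_fun.
move=> w _; apply: bound; rewrite cImM cReJ cImJ /sqnorm.
by rewrite -(sqrrN (Im (axis g w))) [X in _ <= _ + X]addrC; exact: normr_dot2_le.
Qed.

End StableStrictlyProper.

(** * Transfer functions as stable strictly proper fractions *)

Section DecayingFractions.
Local Notation Re := complex.Re.
Local Notation Im := complex.Im.
Local Notation "z ^*" := (conjc z) : ring_scope.
Local Open Scope classical_set_scope.
Variable R : realType.
Local Notation C := R[i].
Local Notation "x %:F" := (tofrac x).
Implicit Types (f g : ratfun R) (z c s a mu : C) (L : seq C) (n d q : {poly C}).

Lemma axis_cvg0 f : stable_sp f -> ccvgy (axis f) 0.
Proof.
move: f; apply: stable_sp_ind => [|c f g sf sg cf cg|L LL L0].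
- by rewrite axis0; exact: ccvgy_cst.
- rewrite axis_linear // -(mulr0 c) -[c * 0]addr0.
  exact: ccvgyD (ccvgyM (ccvgy_cst c) cf) cg.
- rewrite axis_pole_poly //; elim: L LL L0 => // a [_|b L ih] /= /andP[a0 LL] _.
    by under eq_fun do rewrite big_seq1; exact: resolvent_cvg0.
  under eq_fun do rewrite big_cons; rewrite -(mulr0 0).
  exact: ccvgyM (resolvent_cvg0 a0) (ih LL isT).
Qed.

Lemma ccvgy_unique (u : R -> C) z c : ccvgy u z -> ccvgy u c -> z = c.
Proof.
move=> [u1 u2] [v1 v2]; apply: complex_eq.
  exact: (cvg_unique _ u1 v1).
exact: (cvg_unique _ u2 v2).
Qed.

(** A polynomial that vanishes at infinity along the axis is zero: its quotient
    by s + 1 vanishes at infinity too, hence is zero by induction on the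
    degree, and a constant that tends to 0 is 0. *)
Lemma poly_axis_cvg0 q : ccvgy (fun w => q.[0 +i* w]) 0 -> q = 0.
Proof.
move: {2}(size q) (leqnn (size q)) => k; elim: k q => [|k ih] q.
  by rewrite leqn0 size_poly_eq0 => /eqP.
move=> sq q0; pose d : {poly C} := 'X - (-1)%:P; pose c := q.[-1].
(* The divisor s + 1 is used because it has no zero on the axis. *)
have n1 : Re (-1 : C) < 0 by rewrite cReN /= oppr_lt0 ltr01.
have qE : q = q %/ d * d + c%:P by rewrite {1}(divp_eq q d) modp_XsubC.
have hE w : q.[0 +i* w] = (q %/ d).[0 +i* w] * (0 +i* w - -1) + c.
  by rewrite {1}qE hornerD hornerM hornerC hornerXsubC.
have q1 : q %/ d = 0.
  apply: ih.
    by rewrite size_divp ?polyXsubC_eq0 // size_XsubC /= leq_subLR.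
  have := ccvgyM (ccvgyD q0 (ccvgy_cst (- c))) (resolvent_cvg0 n1).
  rewrite mulr0; congr ccvgy; apply/funext => w.
  by rewrite hE addrK mulfK // resolvent_axis_neq0.
have c0 : c = 0.
  apply: (ccvgy_unique (ccvgy_cst c)); move: q0; congr ccvgy.
  by apply/funext => w; rewrite hE q1 horner0 mul0r add0r.
by rewrite qE q1 c0 mul0r add0r.
Qed.

(** Euclidean division splits the fraction into a polynomial and a strictly
    proper part.  The latter tends to 0 along the axis, so if the fraction
    does, the polynomial part is zero by [poly_axis_cvg0]. *)
Lemma stable_sp_frac n d : d != 0 -> (forall s, d.[s] = 0 -> Re s < 0) ->
  ccvgy (axis (n%:F / d%:F)) 0 -> stable_sp (n%:F / d%:F).
Proof.
move=> d0 droot cv.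
have [L dE] := closed_field_poly_normal d.
set c := lead_coef d in dE.
have c0 : c != 0 by rewrite lead_coef_eq0.
have LL : stable_poles L.
  apply/allP => a aL; apply: droot; rewrite dE hornerZ.
  by have /rootP -> : root (\prod_(z <- L) ('X - z%:P)) a;
    rewrite ?mulr0 // root_prod_XsubC.
have dF : d = c *: pole_poly L by [].
have sL : size d = (size L).+1 by rewrite dE size_scale // size_prod_XsubC.
have rs : stable_sp ((n %% d)%:F / d%:F).
  exists (c^-1 *: (n %% d)), L; split => //.
    rewrite size_scale ?invr_eq0 //.
    by have := ltn_modp n d; rewrite d0 sL ltnS.
  rewrite dF -!mul_polyC !tofracM invfM mulrA; congr (_ / _).
  rewrite mulrC; congr (_ * _); apply: (mulfI (x := (c%:P)%:F)).
    by rewrite tofrac_eq0 polyC_eq0.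
  by rewrite mulfV ?tofrac_eq0 ?polyC_eq0 // -tofracM -polyCM mulfV // tofrac1.
have ds0 (w : R) : d.[0 +i* w] != 0.
  by apply/eqP => /droot /=; rewrite ltxx.
have aE w : axis (n%:F / d%:F) w = (n %/ d).[0 +i* w] + axis ((n %% d)%:F / d%:F) w.
  rewrite /axis !rat_evalE // {1}(divp_eq n d) hornerD hornerM mulrDl mulfK //.
have q0 : n %/ d = 0.
  apply: poly_axis_cvg0.
  have := ccvgyD cv (ccvgyM (ccvgy_cst (- 1)) (axis_cvg0 rs)).
  rewrite mulr0 addr0; congr ccvgy; apply/funext => w.
  by rewrite aE mulN1r addrK.
by rewrite (divp_eq n d) q0 mul0r add0r.
Qed.

Lemma strictly_proper_axis p m (F : 'M[ratfun R]_(p, m)) i j :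
  strictly_proper F -> ccvgy (axis (F i j)) 0.
Proof.
move=> spF.
have H (e : R) : 0 < e -> \forall w \near +oo, `|axis (F i j) w| < e%:C.
  move=> e0; have [M hM] := spF i j e e0.
  near=> w; have := hM (0 +i* w); rewrite mxE; apply.
  rewrite normc_def /= expr0n /= add0r sqrtr_sqr ltcR.
  rewrite (lt_le_trans _ (ler_norm _)) //.
  by near: w; apply: nbhs_pinfty_gt; exact: num_real.
split.
  apply/cvgr0Pnorm_lt => e e0; near=> w.
  have : `|axis (F i j) w| < e%:C by near: w; exact: H.
  by move=> /(le_lt_trans (normc_ge_Re _)); rewrite ltcR.
apply/cvgr0Pnorm_lt => e e0; near=> w.
have : `|axis (F i j) w| < e%:C by near: w; exact: H.
(* Multiplication by 'i exchanges the coordinates up to sign. *)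
have -> : `|axis (F i j) w| = `|axis (F i j) w * 'i|.
  by rewrite normrM normc_def [`|'i|]normc_def /= expr0n /= add0r expr1n sqrtr1 mulr1.
by move=> /(le_lt_trans (normc_ge_Re _)); rewrite ltcR ReiNIm normrN.
Unshelve. all: by end_near. Qed.

(** Cramer's rule: the determinant of the pencil is a common denominator of the
    entries of the transfer function. *)
Lemma transfer_frac (n m p : nat) (E A : 'M[C]_n) (B : 'M[C]_(n, m))
    (Cm : 'M[C]_(p, n)) (D : 'M[C]_(p, m)) :
  let P := 'X *: map_mx polyC E - map_mx polyC A in \det P != 0 ->
  exists N : 'M[{poly C}]_(p, m), forall i j,
    transfer E A B Cm D i j = (N i j)%:F / (\det P)%:F.
Proof.
move=> P P0; pose k (a b : nat) (Q : 'M[C]_(a, b)) := map_mx (polyC : C -> {poly C}) Q.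
exists (k _ _ Cm *m \adj P *m k _ _ B + \det P *: k _ _ D) => i j.
have PF : ratX R *: map_mx (@rat_cst R) E - map_mx (@rat_cst R) A
    = map_mx (@tofrac _) P.
  by apply/matrixP => i1 j1; rewrite !mxE tofracB tofracM.
have cF (a b : nat) (Q : 'M[C]_(a, b)) :
    map_mx (@rat_cst R) Q = map_mx (@tofrac _) (k _ _ Q).
  by apply/matrixP => i1 j1; rewrite !mxE.
have Pu : map_mx (@tofrac _) P \in unitmx.
  by rewrite unitmxE det_map_mx unitfE tofrac_eq0.
rewrite /transfer PF !cF /invmx Pu -map_mx_adj det_map_mx -scalemxAr -scalemxAl.
rewrite -!map_mxM !mxE tofracD tofracM mulrDl.
by congr (_ + _); [exact: mulrC | rewrite mulrAC divff ?tofrac_eq0 ?mul1r].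
Qed.

Lemma det_pencil_toC (n : nat) (E A : 'M[R]_n) :
  \det ('X *: map_mx polyC (toCmx E) - map_mx polyC (toCmx A)) =
  map_poly (real_complex R) (\det ('X *: map_mx polyC E - map_mx polyC A)).
Proof.
rewrite -det_map_mx; congr (\det _); apply/matrixP => i j.
by rewrite !mxE rmorphB rmorphM /= map_polyX !map_polyC.
Qed.

Lemma horner_det_pencil (n : nat) (E A : 'M[C]_n) s :
  (\det ('X *: map_mx polyC E - map_mx polyC A)).[s] = \det (s *: E - A).
Proof.
have <- : map_mx (horner_eval s) ('X *: map_mx polyC E - map_mx polyC A) = s *: E - A.
  by apply/matrixP => i j; rewrite !mxE /horner_eval !hornerE.
by rewrite det_map_mx.
Qed.

(** The poles are among the finite eigenvalues of the pencil, which asymptotic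
    stability puts in the left half-plane.  Strict properness is what excludes
    the polynomial part that a singular E may produce. *)
Lemma dae_transfer_stable_sp (n m p : nat) (E A : 'M[R]_n) (B : 'M[R]_(n, m))
    (Cm : 'M[R]_(p, n)) (D : 'M[R]_(p, m)) i j :
  regular_pencil E A -> asymptotically_stable E A ->
  strictly_proper (dae_transfer E A B Cm D) ->
  stable_sp (dae_transfer E A B Cm D i j).
Proof.
move=> reg stab /(strictly_proper_axis i j).
have P0 : \det ('X *: map_mx polyC (toCmx E) - map_mx polyC (toCmx A)) != 0.
  by rewrite det_pencil_toC map_poly_eq0.
have [N NE] := transfer_frac (toCmx B) (toCmx Cm) (toCmx D) P0.
rewrite /dae_transfer NE; apply: stable_sp_frac => // s.
by rewrite horner_det_pencil; exact: stab.
Qed.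

(** In the eigenbasis [T] the resolvent of [A] is diagonal. *)
Lemma resolvent_mx_diag (F K : fieldType) (h : {rmorphism F -> K}) (x : K)
    (m p r : nat) (A T : 'M[F]_r) (lam : 'rV[F]_r)
    (B : 'M[F]_(r, m)) (Q : 'M[F]_(p, r)) i j :
  T \in unitmx -> invmx T *m A *m T = diag_mx lam ->
  (forall k, x - h (lam 0 k) != 0) ->
  (map_mx h Q *m invmx (x%:M - map_mx h A) *m map_mx h B) i j =
  \sum_k h ((Q *m T) i k * (invmx T *m B) k j) * (1 / (x - h (lam 0 k))).
Proof.
move=> Tu TA x0.
pose Dinv := diag_mx (\row_k (1 / (x - h (lam 0 k)))) : 'M[K]_r.
have AT : A *m T = T *m diag_mx lam by rewrite -TA !mulmxA mulmxV // mul1mx.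
set M := _ - map_mx h A.
pose X := map_mx h T *m Dinv *m map_mx h (invmx T).
have hTT : map_mx h T *m map_mx h (invmx T) = 1%:M.
  by rewrite -map_mxM mulmxV // map_mx1.
have MX : M *m X = 1%:M.
  rewrite /X !mulmxA mulmxBl mul_scalar_mx -map_mxM AT map_mxM.
  rewrite -mul_mx_scalar -mulmxBr -(mulmxA _ _ Dinv).
  suff -> : (x%:M - map_mx h (diag_mx lam)) *m Dinv = 1%:M by rewrite mulmx1.
  rewrite map_diag_mx -diag_const_mx -linearB /= mulmx_diag -diag_const_mx.
  by congr diag_mx; apply/rowP => k; rewrite !mxE mul1r mulfV.
have [Mu _] := mulmx1_unit MX.
have -> : invmx M = X by rewrite -[LHS]mulmx1 -MX mulKmx.
rewrite /X !mulmxA -map_mxM -mulmxA -map_mxM mxE; apply: eq_bigr => k _.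
move: (Q *m T) (invmx T *m B) => U W.
by rewrite mul_mx_diag !mxE rmorphM mulrAC.
Qed.

(** Partial fractions of a reduced model: its poles are the entries of [lam] and
    the residue at the k-th one is the product of the k-th column of C T and
    the k-th row of T^-1 B. *)
Lemma transfer_diag (m p r : nat) (AM T : 'M[C]_r) (lam : 'rV[C]_r)
    (BM : 'M[C]_(r, m)) (CM : 'M[C]_(p, r)) i j :
  T \in unitmx -> invmx T *m AM *m T = diag_mx lam ->
  transfer 1%:M AM BM CM 0 i j =
  \sum_k rat_cst ((CM *m T) i k * (invmx T *m BM) k j)
    * (1 / (pole_poly [:: lam 0 k])%:F).
Proof.
move=> Tu TA; pose h : {rmorphism C -> ratfun R} := @tofrac {poly C} \o @polyC C.
have hE (a b : nat) (Q : 'M[C]_(a, b)) : map_mx (@rat_cst R) Q = map_mx h Q.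
  by apply/matrixP => i1 j1; rewrite !mxE.
have pE k : (pole_poly [:: lam 0 k])%:F = ratX R - h (lam 0 k).
  by rewrite /pole_poly big_seq1 tofracB.
have p0 k : ratX R - h (lam 0 k) != 0 by rewrite -pE tofrac_eq0 pole_poly_neq0.
under eq_bigr => k _ do rewrite pE.
rewrite /transfer !hE map_mx1 scalemx1 raddf0 addr0.
exact: (resolvent_mx_diag BM CM i j Tu TA p0).
Qed.

End DecayingFractions.

(** * The inner product of scalar stable strictly proper functions *)

Section InnerProduct.
Local Notation Re := complex.Re.
Local Notation Im := complex.Im.
Local Notation "z ^*" := (conjc z) : ring_scope.
Local Open Scope classical_set_scope.
Variable R : realType.
Local Notation C := R[i].
Local Notation "x %:F" := (tofrac x).
Implicit Types (f g h : ratfun R) (z c s a mu : C) (u v : R -> C).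

Lemma conjcM z c : (z * c)^* = z^* * c^*. Proof. exact: rmorphM. Qed.

Lemma cintegrableD u v : cintegrable u -> cintegrable v ->
  cintegrable (fun w => u w + v w).
Proof.
move=> [u1 u2] [v1 v2]; split.
  by under eq_fun do rewrite cReD EFinD; exact: integrableD u1 v1.
by under eq_fun do rewrite cImD EFinD; exact: integrableD u2 v2.
Qed.

Lemma integralCD u v : cintegrable u -> cintegrable v ->
  integralC (fun w => u w + v w) = integralC u + integralC v.
Proof.
move=> [u1 u2] [v1 v2]; apply: complex_eq => /=.
  by under eq_Rintegral do rewrite cReD; rewrite RintegralD.
by under eq_Rintegral do rewrite cImD; rewrite RintegralD.
Qed.

Lemma cintegrableZ c u : cintegrable u -> cintegrable (fun w => c * u w).
Proof.
move=> [u1 u2]; split.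
  under eq_fun do rewrite cReM EFinB !EFinM.
  by apply: integrableB => //; apply: integrableZl.
under eq_fun do rewrite cImM EFinD !EFinM.
by apply: integrableD => //; apply: integrableZl.
Qed.

Lemma integralCZ c u : cintegrable u ->
  integralC (fun w => c * u w) = c * integralC u.
Proof.
move=> [u1 u2].
have Z (r : R) (t : R -> R) : (@lebesgue_measure R).-integrable setT (EFin \o t) ->
    (@lebesgue_measure R).-integrable setT (EFin \o (fun w => r * t w)).
  by move=> /(integrableZl measurableT r).
apply: complex_eq; rewrite ?cReM ?cImM /=.
  under eq_Rintegral do rewrite cReM.
  by rewrite RintegralB ?RintegralZl //; exact: Z.
under eq_Rintegral do rewrite cImM.
by rewrite RintegralD ?RintegralZl //; exact: Z.
Qed.

Lemma integralCJ u : cintegrable u ->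
  integralC (fun w => (u w)^*) = (integralC u)^*.
Proof.
move=> [u1 u2]; apply: complex_eq => /=.
  by under eq_Rintegral do rewrite cReJ.
under eq_Rintegral do rewrite cImJ -mulN1r.
by rewrite RintegralZl // mulN1r.
Qed.

Lemma cintegrable0 : cintegrable (fun=> 0 : C).
Proof. by split; exact: integrable0. Qed.

Lemma integralC0 : integralC (fun=> 0 : C) = 0.
Proof.
by rewrite -[RHS](mul0r (integralC (fun=> 0))) -integralCZ ?mul0r //;
  exact: cintegrable0.
Qed.

Lemma cintegrable_sum (I : Type) (r : seq I) (u : I -> R -> C) :
  (forall i, cintegrable (u i)) -> cintegrable (fun w => \sum_(i <- r) u i w).
Proof.
move=> ui; elim: r => [|i r ih].
  by under eq_fun do rewrite big_nil; exact: cintegrable0.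
by under eq_fun do rewrite big_cons; exact: cintegrableD.
Qed.

Lemma integralC_sum (I : Type) (r : seq I) (u : I -> R -> C) :
  (forall i, cintegrable (u i)) ->
  integralC (fun w => \sum_(i <- r) u i w) = \sum_(i <- r) integralC (u i).
Proof.
move=> ui; elim: r => [|i r ih].
  by under [X in integralC X]eq_fun do rewrite big_nil;
    rewrite big_nil integralC0.
under [X in integralC X]eq_fun do rewrite big_cons.
by rewrite big_cons integralCD ?ih //; exact: cintegrable_sum.
Qed.

Definition rat_inner f g : C :=
  ((2 * pi)^-1)%:C * integralC (fun w => axis f w * (axis g w)^*).

Lemma rat_inner_linearl c f g h : stable_sp f -> stable_sp g -> stable_sp h ->
  rat_inner (rat_cst c * f + g) h = c * rat_inner f h + rat_inner g h.
Proof.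
move=> sf sg sh; rewrite /rat_inner axis_linear //.
have If := cintegrable_axisM sf sh; have Ig := cintegrable_axisM sg sh.
under [X in integralC X]eq_fun do rewrite mulrDl -mulrA.
by rewrite integralCD ?integralCZ //; [ring | exact: cintegrableZ].
Qed.

Lemma rat_innerJ f g : stable_sp f -> stable_sp g -> rat_inner g f = (rat_inner f g)^*.
Proof.
move=> sf sg; rewrite /rat_inner conjcM conjc_real.
rewrite -integralCJ; last exact: cintegrable_axisM.
congr (_ * integralC _); apply/funext => w.
by rewrite conjcM conjcK mulrC.
Qed.

(** Point evaluation as an inner product: on the axis the conjugate of
    1 / (s - a) is 1 / (mu - s) with mu = - a^*, the mirror image of a, so the
    Cauchy formula applies. *)
Lemma rat_inner_pole f a : stable_sp f -> Re a < 0 ->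
  rat_inner f (1 / (pole_poly [:: a])%:F) = rat_eval f (- a^*).
Proof.
move=> sf a0; have LL : stable_poles [:: a] by rewrite /= a0.
have sg : stable_sp (1 / (pole_poly [:: a])%:F) by exact: stable_sp_pole_poly.
rewrite /rat_inner (@integralC_pv _ _ (2 * (pi : R)%:C * rat_eval f (- a^*))).
- have pi0 : (2 * (pi : R)) != 0 by rewrite mulf_neq0 // gt_eqF // pi_gt0.
  have -> : 2 * (pi : R)%:C = (2 * pi : R)%:C.
    by apply: complex_eq; rewrite ?cReM ?cImM /=; ring.
  by rewrite mulrA -rmorphM /= mulVf // mul1r.
- exact: ccontinuousM (ccontinuous_axis sf) (ccontinuousJ (ccontinuous_axis sg)).
- exact: cintegrable_axisM.
have mu0 : 0 < Re (- a^*) by rewrite cReN cReJ oppr_gt0.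
apply: eq_pv_integral (pv_axis_pole sf mu0) => w.
rewrite axis_pole_poly // big_seq1 /resolvent conjc_inv; congr (_ * _^-1).
by apply: complex_eq; rewrite !(cReD, cImD, cReN, cImN, cReJ, cImJ) /=; ring.
Qed.

Lemma mulJ_sqnorm z : z * z^* = (sqnorm z)%:C.
Proof.
by apply: complex_eq; rewrite ?(cReM, cImM) cReJ cImJ /sqnorm /=; ring.
Qed.

Lemma rat_inner_self f : stable_sp f ->
  rat_inner f f = ((2 * pi)^-1 * \int[@lebesgue_measure R]_w sqnorm (axis f w))%:C.
Proof.
move=> sf; rewrite rmorphM /rat_inner; congr (_ * _); apply: complex_eq => /=.
  by under eq_Rintegral do rewrite mulJ_sqnorm.
under eq_Rintegral do rewrite mulJ_sqnorm /=.
by rewrite Rintegral_cst // mul0r.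
Qed.

Lemma rat_inner_ge0 f : stable_sp f -> 0 <= Re (rat_inner f f).
Proof.
move=> sf; rewrite rat_inner_self //=; apply: mulr_ge0.
  by rewrite invr_ge0 mulr_ge0 // pi_ge0.
by apply: Rintegral_ge0 => w _; exact: sqnorm_ge0.
Qed.

Lemma sqnorm_eq0 z : sqnorm z = 0 -> z = 0.
Proof.
move/eqP; rewrite paddr_eq0 ?sqr_ge0 // !sqrf_eq0 => /andP[/eqP z1 /eqP z2].
exact: complex_eq.
Qed.

(** If the norm is zero, [f] vanishes almost everywhere on the axis, whereas a
    nonzero numerator has finitely many roots. *)
Lemma rat_inner_eq0 f : stable_sp f -> Re (rat_inner f f) = 0 -> f = 0.
Proof.
move=> sf; rewrite rat_inner_self //= => /eqP.
rewrite mulf_eq0 invr_eq0 mulf_eq0 pnatr_eq0 /= gt_eqF ?pi_gt0 //= => /eqP I0.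
pose mu := @lebesgue_measure R.
have [I1 _] := cintegrable_axisM sf sf.
have intf : mu.-integrable setT (fun w => (sqnorm (axis f w))%:E).
  by move: I1; under eq_fun do rewrite mulJ_sqnorm.
have E0 : (\int[mu]_w `|(sqnorm (axis f w))%:E| = 0)%E.
  under eq_integral do rewrite gee0_abs ?lee_fin ?sqnorm_ge0 //.
  by rewrite -[LHS]fineK ?integrable_fin_num // -/(Rintegral _ _ _) I0.
have [N [mN N0 sub]] : {ae mu, forall w, axis f w = 0}.
  have := (ae_eq_integral_abs mu measurableT (measurable_int _ intf)).1 E0.
  apply: filterS => w /(_ I) /= [] /sqnorm_eq0; exact.
case: sf => n [L [LL _ fE]].
have zn w : axis f w = 0 -> root n (0 +i* w).
  rewrite /axis fE rat_eval_stable // => /eqP.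
  rewrite mulf_eq0 invr_eq0 => /orP[] //.
  by rewrite -horner_pole_poly (negbTE (pole_poly_rhp_neq0 _ _)).
have [n0|n0] := eqVneq n 0; first by rewrite fE n0 tofrac0 mul0r.
pose Z := [set w : R | root n (0 +i* w)].
have finZ : finite_set Z.
  have inj : injective (fun w : R => 0 +i* w) by move=> ? ? [].
  apply: (@finite_preimage _ _ [set z : C | root n z]).
    by move=> ? ? _ _; exact: inj.
  have [r nE] := closed_field_poly_normal n.
  apply: (sub_finite_set _ (finite_seq r)) => z /=.
  by rewrite nE rootZ ?lead_coef_eq0 // root_prod_XsubC.
have mZ : measurable Z by exact: countable_measurable (finite_set_countable finZ).
have Z0 : mu Z = 0 := countable_lebesgue_measure0 (finite_set_countable finZ).
have : (mu `[0%R, 1%R] <= mu N + mu Z)%E.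
  apply: (@le_trans _ _ (mu (N `|` Z))); last exact: (@measureU2 _ _ _ mu).
  apply: le_measure; rewrite ?inE //; first exact: measurableU.
  move=> w _; have [/zn|] := pselect (axis f w = 0); first by right.
  by move=> fw; left; apply: sub.
by rewrite N0 Z0 adde0 /mu lebesgue_measure_itv /= lte01 oppr0 adde0 lee_fin ler10.
Qed.

End InnerProduct.

(** * The H2 inner product of matrices *)

Section MatrixInnerProduct.
Local Notation Re := complex.Re.
Local Notation Im := complex.Im.
Local Notation "z ^*" := (conjc z) : ring_scope.
Variable R : realType.
Local Notation C := R[i].
Local Notation "x %:F" := (tofrac x).

Lemma rat_inner_linearr (f g h : ratfun R) (c : C) :
  stable_sp f -> stable_sp g -> stable_sp h ->
  rat_inner f (rat_cst c * g + h) = c^* * rat_inner f g + rat_inner f h.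
Proof.
move=> sf sg sh; have [sgh _] := stable_sp_linear c sg sh.
rewrite (rat_innerJ sgh sf) rat_inner_linearl //.
rewrite (rat_innerJ sg sf) (rat_innerJ sh sf) -conjcM.
exact: rmorphD.
Qed.

Lemma rat_inner_sumr (f : ratfun R) (I : Type) (r : seq I) (c : I -> C)
    (g : I -> ratfun R) :
  stable_sp f -> (forall i, stable_sp (g i)) ->
  stable_sp (\sum_(i <- r) rat_cst (c i) * g i) /\
  rat_inner f (\sum_(i <- r) rat_cst (c i) * g i) =
    \sum_(i <- r) (c i)^* * rat_inner f (g i).
Proof.
move=> sf sg; elim: r => [|i r [ss ih]].
  rewrite !big_nil; split; first exact: stable_sp0.
  have := rat_inner_linearr (- 1) sf (stable_sp0 R) (stable_sp0 R).
  rewrite mulr0 add0r => E; move: (rat_inner f 0) E => z.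
  have -> : (- 1 : C)^* = - 1 by apply/eqP; rewrite eq_complex /= !oppr0 !eqxx.
  by rewrite mulN1r addNr.
rewrite !big_cons; split; first by have [] := stable_sp_linear (c i) (sg i) ss.
by rewrite rat_inner_linearr // ih.
Qed.

Variables p m : nat.
Implicit Types F G H : 'M[ratfun R]_(p, m).

Definition stable_mx F := forall i j, stable_sp (F i j).

Lemma stable_mx_linear c F G : stable_mx F -> stable_mx G ->
  stable_mx (rat_cst c *: F + G).
Proof.
by move=> sF sG i j; rewrite !mxE; have [] := stable_sp_linear c (sF i j) (sG i j).
Qed.

Lemma H2_innerE F H : stable_mx F -> stable_mx H ->
  H2_inner F H = \sum_i \sum_j rat_inner (F i j) (H i j).
Proof.
move=> sF sH.
have -> : H2_inner F H = ((2 * pi)^-1)%:C * integralC (fun w =>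
    \sum_i \sum_j axis (F i j) w * (axis (H i j) w)^*).
  congr (_ * integralC _); apply/funext => w; rewrite /H2_integrand /mxtrace.
  by apply: eq_bigr => i _; rewrite mxE; apply: eq_bigr => j _; rewrite !mxE.
have I i j := cintegrable_axisM (sF i j) (sH i j).
rewrite integralC_sum => [|i]; last exact: cintegrable_sum.
rewrite mulr_sumr; apply: eq_bigr => i _.
by rewrite integralC_sum // mulr_sumr.
Qed.

Lemma H2_inner_linearl c F G H : stable_mx F -> stable_mx G -> stable_mx H ->
  H2_inner (rat_cst c *: F + G) H = c * H2_inner F H + H2_inner G H.
Proof.
move=> sF sG sH; rewrite !H2_innerE //; last exact: stable_mx_linear.
rewrite mulr_sumr -big_split; apply: eq_bigr => i _ /=.
rewrite mulr_sumr -big_split; apply: eq_bigr => j _ /=.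
by rewrite !mxE; exact: rat_inner_linearl (sF i j) (sG i j) (sH i j).
Qed.

Lemma H2_innerJ F G : stable_mx F -> stable_mx G ->
  H2_inner G F = (H2_inner F G)^*.
Proof.
move=> sF sG; rewrite !H2_innerE // [RHS]rmorph_sum; apply: eq_bigr => i _.
by rewrite [RHS]rmorph_sum; apply: eq_bigr => j _; exact: rat_innerJ (sF i j) (sG i j).
Qed.

Definition H2_sqnorm F : R := Re (H2_inner F F).

Lemma H2_sqnormE F : stable_mx F ->
  H2_sqnorm F = \sum_i \sum_j Re (rat_inner (F i j) (F i j)).
Proof.
move=> sF; rewrite /H2_sqnorm H2_innerE // (big_morph _ (@cReD R) (erefl _)).
by apply: eq_bigr => i _; rewrite (big_morph _ (@cReD R) (erefl _)).
Qed.

Lemma H2_sqnorm_ge0 F : stable_mx F -> 0 <= H2_sqnorm F.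
Proof.
move=> sF; rewrite H2_sqnormE //; apply: sumr_ge0 => i _; apply: sumr_ge0 => j _.
exact: rat_inner_ge0 (sF i j).
Qed.

Lemma H2_sqnorm_eq0 F : stable_mx F -> H2_sqnorm F = 0 -> F = 0.
Proof.
move=> sF; rewrite H2_sqnormE // => /eqP.
have pos i j : 0 <= Re (rat_inner (F i j) (F i j)) by exact: rat_inner_ge0 (sF i j).
rewrite psumr_eq0 => [/allP z|i _]; last by apply: sumr_ge0 => j _.
apply/matrixP => i j; rewrite mxE; apply: rat_inner_eq0 (sF i j) _.
have /= := z i (mem_index_enum _).
rewrite psumr_eq0 => [/allP zj|? _]; last exact: pos.
exact/eqP/(zj j (mem_index_enum _)).
Qed.

Lemma H2_norm_le F G : stable_mx F -> stable_mx G ->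
  (H2_norm F <= H2_norm G) = (H2_sqnorm F <= H2_sqnorm G).
Proof. by move=> sF sG; rewrite /H2_norm ler_sqrt // H2_sqnorm_ge0. Qed.

Lemma H2_sqnorm_linear c F G : stable_mx F -> stable_mx G ->
  H2_sqnorm (rat_cst c *: F + G) =
    sqnorm c * H2_sqnorm F + H2_sqnorm G + 2 * Re (c * H2_inner F G).
Proof.
move=> sF sG; have sFG := stable_mx_linear c sF sG.
rewrite /H2_sqnorm H2_inner_linearl // (@H2_innerJ _ F) //.
rewrite (@H2_innerJ _ G) // !H2_inner_linearl //.
have FF0 : Im (H2_inner F F) = 0.
  have /(congr1 (@complex.Im _)) := H2_innerJ sF sF; rewrite cImJ; lra.
rewrite (H2_innerJ sF sG) /sqnorm.
move: (H2_inner F F) (H2_inner F G) (H2_inner G G) FF0 => x y z FF0.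
rewrite !(cReD, cImD, cReM, cImM, cReJ, cImJ) FF0; ring.
Qed.

Lemma rat_cst1 : rat_cst (1 : C) = 1. Proof. exact: tofrac1. Qed.

Lemma rat_cstN1 : rat_cst (- 1 : C) = - 1.
Proof. by rewrite /rat_cst polyCN tofracN; congr (- _); exact: tofrac1. Qed.

Lemma stable_mxB F G : stable_mx F -> stable_mx G -> stable_mx (F - G).
Proof.
by move=> sF sG; have := stable_mx_linear (- 1) sG sF; rewrite rat_cstN1 scaleN1r addrC.
Qed.

Lemma ratmx_evalB F G s : stable_mx F -> stable_mx G -> 0 <= Re s ->
  ratmx_eval (F - G) s = ratmx_eval F s - ratmx_eval G s.
Proof.
move=> sF sG s0; apply/matrixP => i j; rewrite !mxE.
have [_ /(_ _ s0)] := stable_sp_linear (- 1) (sG i j) (sF i j).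
by rewrite rat_cstN1 !mulN1r addrC [RHS]addrC.
Qed.

End MatrixInnerProduct.

(** * Best approximation from a subspace *)

Section Projection.
Local Notation Re := complex.Re.
Local Notation Im := complex.Im.
Local Notation "z ^*" := (conjc z) : ring_scope.
Variable R : realType.
Local Notation C := R[i].
Variables p m : nat.
Implicit Types F G H : 'M[ratfun R]_(p, m).
Variable V : set 'M[ratfun R]_(p, m).
Hypothesis V_stable : forall F, V F -> stable_mx F.
Hypothesis V_lin : forall c F G, V F -> V G -> V (rat_cst c *: F + G).
Variables (G Gr : 'M[ratfun R]_(p, m)).
Hypotheses (sG : stable_mx G) (VGr : V Gr).

Let sE : stable_mx (G - Gr). Proof. by apply: stable_mxB => //; exact: V_stable. Qed.

(** If z = <G - Gr, GM> were nonzero, moving from [Gr] by a small multiple of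
    z GM would decrease the distance to [G]. *)
Lemma minimizer_orthogonal :
  (forall GM, V GM -> H2_norm (G - Gr) <= H2_norm (G - GM)) ->
  forall GM, V GM -> H2_inner (G - Gr) GM = 0.
Proof.
move=> min GM VM; have sM := V_stable VM.
set z := H2_inner (G - Gr) GM; pose N := H2_sqnorm GM.
have N0 : 0 <= N := H2_sqnorm_ge0 sM.
(* This step makes t N = 1 - t < 1, so the quadratic term does not offset the
   linear one. *)
pose t : R := (1 + N)^-1.
have := min _ (V_lin (t%:C * z) VM VGr).
have sN := V_stable (V_lin (t%:C * z) VM VGr).
have E : G - (rat_cst (t%:C * z) *: GM + Gr)
    = rat_cst (- (t%:C * z)) *: GM + (G - Gr).
  by rewrite /rat_cst polyCN tofracN scaleNr opprD addrCA.
rewrite H2_norm_le //; last exact: stable_mxB.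
rewrite E H2_sqnorm_linear // (@H2_innerJ _ _ _ (G - Gr)) // -/z -/N.
have -> : Re (- (t%:C * z) * z^*) = - (t * sqnorm z).
  by rewrite /sqnorm !(cReN, cImN, cReM, cImM, cReJ, cImJ) /=; ring.
have -> : sqnorm (- (t%:C * z)) = t ^+ 2 * sqnorm z.
  by rewrite /sqnorm !(cReN, cImN, cReM, cImM, cReJ, cImJ) /=; ring.
have t0 : 0 < t by rewrite invr_gt0 ltr_pwDl.
have tN : t * N = 1 - t.
  by rewrite /t; field; rewrite gt_eqF // ltr_pwDl.
move=> le; apply: sqnorm_eq0; apply/eqP; rewrite eq_le sqnorm_ge0 andbT.
clearbody N t z; move: le (sqnorm_ge0 z).
move: (sqnorm z) (H2_sqnorm _) => y S le y0.
have E2 : t ^+ 2 * y * N = t * y - t ^+ 2 * y.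
  have -> : t ^+ 2 * y * N = t * y * (t * N) by ring.
  by rewrite tN; ring.
have ty : 0 <= t ^+ 2 * y by rewrite mulr_ge0 // sqr_ge0.
rewrite -(pmulr_rle0 _ t0); rewrite E2 in le; lra.
Qed.

Lemma pythagoras : (forall GM, V GM -> H2_inner (G - Gr) GM = 0) ->
  forall GM, V GM -> H2_sqnorm (G - GM) = H2_sqnorm (Gr - GM) + H2_sqnorm (G - Gr).
Proof.
move=> ort GM VM; have VD : V (Gr - GM).
  by have := V_lin (- 1) VM VGr; rewrite rat_cstN1 scaleN1r addrC.
have sD := V_stable VD.
have -> : G - GM = rat_cst 1 *: (Gr - GM) + (G - Gr).
  by rewrite rat_cst1 scale1r [RHS]addrC subrKA.
rewrite H2_sqnorm_linear // (@H2_innerJ _ _ _ (G - Gr)) // ort //.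
by rewrite conjc0 mulr0 /sqnorm /= expr1n expr0n /= !(addr0, mulr0, mul1r).
Qed.

(** By Pythagoras the squared distance from [G] to [GM] exceeds the one to [Gr]
    by the squared norm of Gr - GM, which is positive unless GM = Gr. *)
Lemma orthogonal_unique_minimizer :
  (forall GM, V GM -> H2_inner (G - Gr) GM = 0) ->
  (forall GM, V GM -> H2_norm (G - Gr) <= H2_norm (G - GM)) /\
  forall GM, V GM -> H2_norm (G - GM) <= H2_norm (G - Gr) -> GM = Gr.
Proof.
move=> ort; have P := pythagoras ort.
have sV GM (VM : V GM) : stable_mx (G - GM) := stable_mxB sG (V_stable VM).
have sD GM (VM : V GM) : stable_mx (Gr - GM) := stable_mxB (V_stable VGr) (V_stable VM).
split=> GM VM.
  rewrite (H2_norm_le sE (sV _ VM)) (P _ VM) lerDr.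
  exact: H2_sqnorm_ge0 (sD _ VM).
rewrite (H2_norm_le (sV _ VM) sE) (P _ VM) gerDr => le0.
have N0 : H2_sqnorm (Gr - GM) = 0.
  by apply: le_anti; rewrite le0; exact: H2_sqnorm_ge0 (sD _ VM).
by apply/esym/eqP; rewrite -subr_eq0 (H2_sqnorm_eq0 (sD _ VM) N0).
Qed.

End Projection.

(** * Reduced models and tangential interpolation *)

(** Stated for variables, because rewriting with [mxE] also expands the entries
    of concrete matrices such as transfer functions. *)
Lemma scale_addmxE (K : pzRingType) (p m : nat) (a : K) (F G : 'M[K]_(p, m)) i j :
  (a *: F + G) i j = a * F i j + G i j.
Proof. by rewrite !mxE. Qed.

Section ReducedModels.
Local Notation Re := complex.Re.
Local Notation Im := complex.Im.
Local Notation "z ^*" := (conjc z) : ring_scope.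
Variable R : realType.
Local Notation C := R[i].
Local Notation "x %:F" := (tofrac x).
Variables (m p q : nat) (AM T : 'M[C]_q) (BM : 'M[C]_(q, m)) (lam : 'rV[C]_q).
Hypothesis hAM : forall mu : C, eigenvalue AM mu -> Re mu < 0.
Hypotheses (hT : T \in unitmx) (hTlam : invmx T *m AM *m T = diag_mx lam).

Lemma pole_lt0 k : Re (lam 0 k) < 0.
Proof.
apply: hAM; apply/eigenvalueP; exists (row k (invmx T)).
  rewrite -row_mul; have -> : invmx T *m AM = diag_mx lam *m invmx T.
    by rewrite -hTlam -!mulmxA mulmxV // mulmx1.
  by rewrite row_mul row_diag_mx -scalemxAl -rowE.
apply/eqP => r0.
have : row k (invmx T *m T) = 0 by rewrite row_mul r0 mul0mx.
rewrite mulVmx // => /rowP/(_ k); rewrite !mxE eqxx => /eqP.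
by rewrite oner_eq0.
Qed.

Lemma stable_sp_pole k : stable_sp (1 / (pole_poly [:: lam 0 k])%:F).
Proof. by apply: stable_sp_pole_poly => //=; rewrite pole_lt0. Qed.

Lemma reduced_models_stable GM : @reduced_models R p m q AM BM GM -> stable_mx GM.
Proof.
move=> [CM ->] i j; rewrite (transfer_diag _ _ _ _ hT hTlam).
have [] := @rat_inner_sumr R _ _ (index_enum _)
  (fun k => (CM *m T) i k * (invmx T *m BM) k j) _
  (stable_sp0 R) stable_sp_pole.
by [].
Qed.

Lemma reduced_models_linear c F G : @reduced_models R p m q AM BM F ->
  @reduced_models R p m q AM BM G -> @reduced_models R p m q AM BM (rat_cst c *: F + G).
Proof.
move=> [C1 ->] [C2 ->]; exists (c *: C1 + C2); apply/matrixP => i j.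
have tE CM := transfer_diag BM CM i j hT hTlam.
rewrite scale_addmxE.
apply: etrans (congr2 (fun x y => rat_cst c * x + y) (tE C1) (tE C2)) _.
apply: etrans (esym (tE (c *: C1 + C2))); rewrite mulr_sumr -big_split /=.
apply: eq_bigr => k _; rewrite mulrA -mulrDl; congr (_ * _).
rewrite /rat_cst -tofracM -tofracD -polyCM -polyCD; congr (_ %:P)%:F.
by rewrite mulmxDl -scalemxAl scale_addmxE mulrDl mulrA.
Qed.

Lemma residual_entry (F : 'M[ratfun R]_(p, m)) s k i :
  (ratmx_eval F s *m input_direction T BM k) i 0 =
  \sum_j rat_eval (F i j) s * ((invmx T *m BM) k j)^*.
Proof.
rewrite /input_direction; move: (invmx T *m BM) => W.
by rewrite mxE; apply: eq_bigr => j _; rewrite !mxE.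
Qed.

(** The inner product with a reduced model pairs the columns of C T with the
    values of [F] at the mirror images of the poles, applied to the input
    residual directions. *)
Lemma H2_inner_reduced (F : 'M[ratfun R]_(p, m)) (CM : 'M[C]_(p, q)) :
  stable_mx F ->
  H2_inner F (transfer 1%:M AM BM CM 0) = \sum_k \sum_i ((CM *m T) i k)^* *
    (ratmx_eval F (- (lam 0 k)^*) *m input_direction T BM k) i 0.
Proof.
move=> sF; have sM : stable_mx (transfer 1%:M AM BM CM 0).
  by apply: reduced_models_stable; exists CM.
rewrite H2_innerE // exchange_big /=.
under eq_bigr => j _.
  under eq_bigr => i _.
    rewrite (transfer_diag _ _ _ _ hT hTlam).
    have [_ ->] := rat_inner_sumr (index_enum _)
      (fun k => (CM *m T) i k * (invmx T *m BM) k j) (sF i j) stable_sp_pole.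
    under eq_bigr => k _ do rewrite rat_inner_pole ?pole_lt0 // conjcM.
    over.
  rewrite exchange_big /=.
  over.
rewrite exchange_big /=; apply: eq_bigr => k _.
rewrite exchange_big /=; apply: eq_bigr => i _.
rewrite residual_entry mulr_sumr; apply: eq_bigr => j _; ring.
Qed.

(** As [CM] ranges over all matrices so does CM T, since [T] is invertible; the
    choices CM T = [delta_mx i k] isolate the entries of the residuals in
    [H2_inner_reduced]. *)
Lemma orthogonal_interpolation (F : 'M[ratfun R]_(p, m)) : stable_mx F ->
  (forall GM, reduced_models AM BM GM -> H2_inner F GM = 0) <->
  (forall k, ratmx_eval F (- (lam 0 k)^*) *m input_direction T BM k = 0).
Proof.
move=> sF; split=> [ort k|int GM [CM ->]]; last first.
  rewrite H2_inner_reduced // big1 // => k _; rewrite big1 // => i _.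
  by rewrite int [(0 : 'cV[C]_p) i 0]mxE mulr0.
apply/matrixP => i j; rewrite [j]ord1 [RHS]mxE {j}.
have V : @reduced_models R p m q AM BM
    (transfer 1%:M AM BM (delta_mx i k *m invmx T) 0).
  by exists (delta_mx i k *m invmx T).
have := ort _ V; rewrite H2_inner_reduced // mulmxKV //.
rewrite (bigD1 k) //= [X in _ + X]big1 => [|l lk]; last first.
  by apply: big1 => i' _; rewrite mxE (negbTE lk) andbF conjc0 mul0r.
rewrite addr0 (bigD1 i) //= [X in _ + X]big1 => [|i' ii]; last first.
  by rewrite mxE (negbTE ii) conjc0 mul0r.
by rewrite [delta_mx _ _ _ _]mxE !eqxx conjc1 mul1r addr0.
Qed.

End ReducedModels.

Theorem theorem8 (R : realType) (n m p q : nat)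
    (E A : 'M[R]_n) (B : 'M[R]_(n, m)) (Cm : 'M[R]_(p, n)) (D : 'M[R]_(p, m))
    (hreg : regular_pencil E A)
    (hstab : asymptotically_stable E A)
    (hH2 : H2 (dae_transfer E A B Cm D))
    (hsp : strictly_proper (dae_transfer E A B Cm D))
    (AM : 'M[R[i]]_q) (BM : 'M[R[i]]_(q, m))
    (hdiag : diagonalizable AM)
    (hAM : forall mu : R[i], eigenvalue AM mu -> complex.Re mu < 0)
    (T : 'M[R[i]]_q) (lam : 'rV[R[i]]_q)
    (hT : T \in unitmx)
    (hTlam : invmx T *m AM *m T = diag_mx lam)
    (Gr : 'M[ratfun R]_(p, m))
    (hGr : reduced_models AM BM Gr) :
  let G := dae_transfer E A B Cm D in
  let cond1 := unique_pseudo_optimal G AM BM Gr in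
  let cond2 := forall GM, reduced_models AM BM GM -> H2_inner (G - Gr) GM = 0 in
  let cond3 := forall i : 'I_q,
    (ratmx_eval G (- (lam 0 i)^*) - ratmx_eval Gr (- (lam 0 i)^*))
      *m input_direction T BM i = 0 in
  (cond1 <-> cond2) /\ (cond2 <-> cond3).
Proof.
move=> G cond1 cond2 cond3.
have sG : stable_mx G by move=> i j; exact: dae_transfer_stable_sp.
have sV := @reduced_models_stable R m p q AM T BM lam hAM hT hTlam.
have linV := @reduced_models_linear R m p q AM T BM lam hT hTlam.
have sGr := sV _ hGr.
have sE : stable_mx (G - Gr) by exact: stable_mxB.
split; last first.
  have mirror_ge0 i : 0 <= complex.Re (- conjc (lam 0 i)).
    by rewrite cReN cReJ oppr_ge0; exact: ltW (pole_lt0 hAM hT hTlam i).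
  have evalE i : ratmx_eval G (- (lam 0 i)^*) - ratmx_eval Gr (- (lam 0 i)^*)
      = ratmx_eval (G - Gr) (- (lam 0 i)^*).
    exact: (esym (ratmx_evalB sG sGr (mirror_ge0 i))).
  have [toI ofI] := orthogonal_interpolation BM hAM hT hTlam sE.
  split=> [ort i|int]; first by rewrite evalE; exact: toI.
  by apply: ofI => i; have := int i; rewrite evalE.
split=> [[[_ min] _]|ort].
  exact: (minimizer_orthogonal sV linV sG hGr min).
have [min uniq] := orthogonal_unique_minimizer sV linV sG hGr ort.
split; first exact: (conj hGr min).
by move=> Gr' [VGr' min']; exact: (uniq _ VGr' (min' _ hGr)).
Qed.
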